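(* Let $\mathcal{C}\subset\mathbb{P}^2(\mathbb{K})$ be a rational algebraic plane curve, not a line, defined by a proper parametrization $\mathcal{P}(t)=(p_1(t):p_2(t):p(t))$ with $p_1,p_2,p\in\mathbb{K}[t]$ and $\gcd(p_1,p_2,p)=1$, with limit point $P_L$. Let $P_1,\ldots,P_n$ be the singular points of $\mathcal{C}$, with multiplicities $m_1,\ldots,m_n$ respectively. Assume that they are all ordinary singularities and that $P_i\neq P_L$ for $i=1,\ldots,n$. Then, up to multiplication by a nonzero constant of $\mathbb{K}$, $$T(s)=\prod_{i=1}^n H_{P_i}(s)^{m_i-1},$$ where $T(s)$ is the T-function of $\mathcal{P}(t)$ and $H_{P_i}$ is the fibre function of $P_i$ at $\mathcal{P}(t)$.
   Context: $\mathbb{K}$ is an algebraically closed field of characteristic zero. The parametrization $\mathcal{P}(t)$ is proper if the induced rational map $\mathbb{K}\to\mathcal{C}$, $t\mapsto\mathcal{P}(t)$, is birational (has degree 1). Limit point: let $d=\max\{\deg p_1,\deg p_2,\deg p\}$ and let $a_d,b_d,c_d$ be the coefficients of $t^d$ in $p_1,p_2,p$ respectively. Then $P_L=(a_d:b_d:c_d)$. Fibre function: for $P=(a:b:c)\in\mathbb{P}^2(\mathbb{K})$, $H_P(t)=\gcd(\phi_1,\phi_2,\phi_3)$, where $\phi_1(t)=a\,p(t)-c\,p_1(t)$, $\phi_2(t)=b\,p(t)-c\,p_2(t)$, $\phi_3(t)=a\,p_2(t)-b\,p_1(t)$ (defined up to a nonzero constant). Singularities: the multiplicity of a point $P$ on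 $\mathcal{C}$ is the order of vanishing at $P$ of the implicit polynomial defining $\mathcal{C}$; $P$ is singular if its multiplicity is $>1$. The tangents at $P$ are the irreducible (linear) factors of the first nonvanishing form of the Taylor expansion at $P$ of the implicit polynomial, counted with multiplicity. A singular point of multiplicity $m$ is ordinary if its $m$ tangents are pairwise different. T-function: let $G_1(s,t)=p_1(s)p(t)-p(s)p_1(t)$, $G_2(s,t)=p_2(s)p(t)-p(s)p_2(t)$, $G_3(s,t)=p_1(s)p_2(t)-p_2(s)p_1(t)$. Put $\delta_i=\deg_t(G_i)$, $\lambda_{ij}=\min\{\delta_i,\delta_j\}$, $G_i^*(s,t)=G_i(s,t)/(t-s)\in\mathbb{K}[s,t]$, and $R_{ij}(s)=\mathrm{Res}_t(G_i^*,G_j^* )\in\mathbb{K}[s]$ for $i<j$ (resultant with respect to $t$ of polynomials in $(\mathbb{K}[s])[t]$, taken with their actual degrees in $t$; for $A$ with leading coefficient $\mathrm{lc}_t(A)$ and roots $\alpha_i(s)$ in an algebraic closure of $\mathbb{K}(s)$, $\mathrm{Res}_t(A,B)=\mathrm{lc}_t(A)^{\deg_t B}\prod_i B(s,\alpha_i(s))$). The T-function of $\mathcal{P}(t)$ is $T(s)=R_{12}(s)/p(s)^{\lambda_{12}-1}$. *)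

(* Defs.v *)
From mathcomp Require Import all_boot all_order all_algebra.
From mathcomp.multinomials Require Import mpoly.

Set Implicit Arguments.
Unset Strict Implicit.
Unset Printing Implicit Defensive.

Import GRing.Theory.
Local Open Scope ring_scope.

Section Definitions.
Variable K : closedFieldType.

Implicit Types (F : {mpoly K[3]}) (x : 'rV[K]_3).

(* A point of P^2(K) is given by a nonzero vector of homogeneous coordinates;
   two such vectors are the same point iff they span the same line, i.e. iff
   (x == y)%MS. *)
Definition point (a b c : K) : 'rV[K]_3 :=
  \row_(j < 3) tnth [tuple a; b; c] j.

Definition form_at F x : K := F.@[x 0].

Definition mpoly_irreducible F : Prop :=
  F \isn't a GRing.unit /\
  forall A B : {mpoly K[3]},
    F = A * B -> A \is a GRing.unit \/ B \is a GRing.unit.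

(* F is the implicit polynomial of an irreducible curve of P^2(K). *)
Definition curve_form F : Prop := F \is homog mdeg /\ mpoly_irreducible F.

Definition param_at (p1 p2 p : {poly K}) (t : K) : 'rV[K]_3 :=
  point p1.[t] p2.[t] p.[t].

Definition parametrizes F (p1 p2 p : {poly K}) : Prop :=
  forall t, form_at F (param_at p1 p2 p t) = 0.

(* t |-> (p1(t) : p2(t) : p(t)) is birational from K to the curve F = 0: it has
   an inverse rational map, given on the curve by M / N with M, N forms of the
   same degree and N not identically zero on the curve. *)
Definition proper_param F (p1 p2 p : {poly K}) : Prop :=
  exists k (M N : {mpoly K[3]}),
    [/\ M \is k.-homog /\ N \is k.-homog,
        exists t, form_at N (param_at p1 p2 p t) != 0,
        forall t, form_at N (param_at p1 p2 p t) != 0 ->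
          form_at M (param_at p1 p2 p t) / form_at N (param_at p1 p2 p t) = t
      & forall x, x != 0 -> form_at F x = 0 -> form_at N x != 0 ->
          (param_at p1 p2 p (form_at M x / form_at N x) == x)%MS].

Definition param_degree (p1 p2 p : {poly K}) : nat :=
  maxn (maxn (size p1).-1 (size p2).-1) (size p).-1.

Definition limit_point (p1 p2 p : {poly K}) : 'rV[K]_3 :=
  let d := param_degree p1 p2 p in point p1`_d p2`_d p`_d.

Definition fibre_function (p1 p2 p : {poly K}) x : {poly K} :=
  let: (a, b, c) := (x 0 0, x 0 1, x 0 2) in
  gcdp (gcdp (a *: p - c *: p1) (b *: p - c *: p2)) (a *: p2 - b *: p1).

(* The Taylor expansion of F at x, as the polynomial F(x + X) in X. Changing
   the homogeneous coordinates of the point only rescales its homogeneous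
   components and the variables. *)
Definition taylor F x : {mpoly K[3]} :=
  F \mPo [tuple (x 0 i)%:MP + 'X_i | i < 3].

Definition taylor_form F x (k : nat) : {mpoly K[3]} :=
  pihomog mdeg k (taylor F x).

(* The order of vanishing of F at x: the first k with taylor_form F x k != 0
   (for F != 0). *)
Definition multiplicity F x : nat :=
  find (fun k => taylor_form F x k != 0) (iota 0 (msize (taylor F x))).

Definition singular F x : Prop := (1 < multiplicity F x)%N.

(* The m irreducible factors L i of the first nonvanishing form of the Taylor
   expansion at x are the tangents at x. *)
Definition ordinary F x : Prop :=
  let m := multiplicity F x in
  exists L : 'I_m -> {mpoly K[3]},
    [/\ forall i, mpoly_irreducible (L i),
        taylor_form F x m = \prod_i L i
      & forall i j, i != j -> ~ exists2 c : K, c != 0 & L i = c *: L j].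

(* Polynomials in s and t are elements of {poly {poly K}}, with t the outer
   variable: f%:P is f(s), f^:P is f(t), and size is one more than deg_t. *)
Definition cross (f g : {poly K}) : {poly {poly K}} :=
  f%:P * g^:P - g%:P * f^:P.

Definition G1 (p1 p2 p : {poly K}) := cross p1 p.
Definition G2 (p1 p2 p : {poly K}) := cross p2 p.

(* G / (t - s) *)
Definition star (G : {poly {poly K}}) : {poly {poly K}} := G %/ ('X - 'X%:P).

Definition lambda12 (p1 p2 p : {poly K}) : nat :=
  minn (size (G1 p1 p2 p)).-1 (size (G2 p1 p2 p)).-1.

(* The resultant with respect to the outer variable t, i.e. the Sylvester
   determinant for the actual degrees in t; it agrees with the product formula
   over the roots up to sign. *)
Definition R12 (p1 p2 p : {poly K}) : {poly K} :=
  resultant (star (G1 p1 p2 p)) (star (G2 p1 p2 p)).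

(* The T-function is a priori only a rational function of s. *)
Definition T_function (p1 p2 p : {poly K}) : {fraction {poly K}} :=
  tofrac (R12 p1 p2 p) / tofrac p ^+ (lambda12 p1 p2 p - 1).

End Definitions.

(* Main.v *)
Require Import Defs.
From mathcomp Require Import all_boot all_order perm all_algebra.
From mathcomp.multinomials Require Import mpoly.
From mathcomp Require Import ring zify.

Set Implicit Arguments.
Unset Strict Implicit.
Unset Printing Implicit Defensive.

Import GRing.Theory.
Local Open Scope ring_scope.

(** Write P = (p1, p2, p) and let d be the maximal degree of its components. For a
    vector Q, the polynomial det(Q, P(u), P(w)) / (u - w) has degree less than d in
    each variable. Its coefficient matrix B(Q), of size d, depends linearly on Q. Both
    the implicit form F and the T-function can be read off this matrix.

    The vector (1, s, ..., s^(d-1)) is in the kernel of B(P(s)), so the form det B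
    vanishes on the curve. On a generic line det B has d distinct zeros that are points of
    the curve, because the parametrization is proper; hence det B divides the
    irreducible form F, and F = c det B ([implicit_bez_form]).

    As B(P(s)) is symmetric with a known kernel, its adjugate is the product of the
    matrix (s^(i+j)) and the minor tau(s) that omits the first row and the first column
    ([pencil_minor]). A first-order expansion of the determinant then shows that along
    the curve the gradient of F is c tau times the cross product of P' and P
    ([pencil_gradient]).

    By bilinearity p B(P(s)) is the Bezout matrix of G_1 and G_2 with respect to t. The
    factors t - s of G_1 and G_2 reduce its minor to the Bezout determinant of
    G_1 / (t - s) and G_2 / (t - s), which is their resultant up to a power of p and a
    constant. So T is a constant times tau ([T_function_minor]), and it remains to show
    that tau is a constant times the product of the H_i^(m_i - 1).

    The product divides tau. A generic line through a point x, different from the limit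
    point, meets the curve in d - deg H distinct points outside x, where H is the
    fibre function of x; as F has degree d, the multiplicity m of x is at most deg H.
    Moreover B(x) has rank at most d - deg H, and P is a multiple of x modulo H, so all
    minors of B(P(s)) of size d - 1 are divisible by H^(m - 1)
    ([fibre_corank_dvd_minor], [fibre_power_dvd_minor]).

    The quotient has no zero. By the gradient identity the order of tau at s is at
    most the order at s of the gradient of F along the curve. If P(s) is a regular
    point this order is zero ([minor_neq0_regular]). At an ordinary singular point x
    whose fibre function has order e at s, the branch is tangent to exactly one of the
    m distinct tangents; the derivative of F transversally to that tangent has order
    exactly e (m - 1), which is the order of H^(m - 1) ([minor_order_le_ordinary]). *)

(** * Bezout matrices *)

Section BezoutMatrix.
Variable R : comNzRingType.
Implicit Types (f g h : {poly R}) (n i : nat).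

(** The polynomial [drop_poly i.+1 f] is the coefficient of u^i in
    (f(u) - f(w)) / (u - w). So [bez_row f g i] is the coefficient of u^i, as a polynomial
    in w, of the Bezout quotient (f(u) g(w) - g(u) f(w)) / (u - w). *)
Definition bez_row f g i := drop_poly i.+1 f * g - drop_poly i.+1 g * f.

Definition bezmx n f g : 'M[R]_n := \matrix_(i, j) (bez_row f g i)`_j.

(** The terms of high degree cancel in [bez_row]; in this form the degree bound
    [size_bez_row] is visible. *)
Lemma bez_row_trunc f g i :
  bez_row f g i
    = drop_poly i.+1 f * take_poly i.+1 g - drop_poly i.+1 g * take_poly i.+1 f.
Proof.
rewrite /bez_row -{2}(poly_take_drop i.+1 f) -{1}(poly_take_drop i.+1 g).
by ring.
Qed.

Lemma size_bez_row n f g i :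
  (size f <= n.+1)%N -> (size g <= n.+1)%N -> (i < n)%N ->
  (size (bez_row f g i) <= n)%N.
Proof.
move=> sf sg lt_in; have bound (u v : {poly R}) : (size u <= n.+1)%N ->
    (size (drop_poly i.+1 u * take_poly i.+1 v)%R <= n)%N.
  move=> su; apply: leq_trans (size_polyMleq _ _) _.
  have := size_take_poly i.+1 v; rewrite size_drop_poly.
  move: su; move: (size u) (size (take_poly _ _)) => a b; lia.
rewrite bez_row_trunc; apply: leq_trans (size_polyD _ _) _.
by rewrite size_polyN geq_max !bound.
Qed.

Lemma bez_row_horner n f g (i : 'I_n) w :
  (size f <= n.+1)%N -> (size g <= n.+1)%N ->
  \sum_(j < n) bezmx n f g i j * w ^+ j = (bez_row f g i).[w].
Proof.
move=> sf sg; rewrite (horner_coef_wide _ (size_bez_row sf sg (ltn_ord i))).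
by apply: eq_bigr => j _; rewrite mxE.
Qed.

Lemma drop_poly_shift f i : drop_poly i f = drop_poly i.+1 f * 'X + (f`_i)%:P.
Proof.
apply/polyP=> -[|k]; rewrite !(coefD, coefMX, coefC, coef_drop_poly) /=.
  by rewrite add0n add0r.
by rewrite addr0 addnS.
Qed.

Lemma sum_drop_poly_deriv n f : (size f <= n.+1)%N ->
  \sum_(i < n) drop_poly i.+1 f * 'X^i = f^`().
Proof.
move=> sf; apply/polyP=> k; rewrite coef_sum coef_deriv.
have [le_nk|lt_kn] := leqP n k.
  rewrite [in RHS]nth_default ?mul0rn ?(leq_trans sf) //.
  rewrite big1 // => i _; rewrite coefMXn coef_drop_poly.
  case: ltnP => // le_ik; rewrite nth_default //.
  by rewrite (leq_trans sf) // addnS subnK.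
rewrite (eq_bigr (fun i : 'I_n => if (i < k.+1)%N then f`_k.+1 else 0)); last first.
  move=> i _; rewrite coefMXn coef_drop_poly ltnS.
  by case: ltnP => // le_ik; rewrite addnS subnK.
rewrite -big_mkcond /= (eq_bigl (fun i : 'I_n => (i < k.+1)%N)) //.
rewrite -(big_ord_widen n (fun=> f`_k.+1)) //.
by rewrite sumr_const card_ord.
Qed.

(** The polynomial (f(u) g(w) - g(u) f(w)) / (u - w), with [u] the outer variable
    and [w] the inner one: the Bezout matrix as a bivariate polynomial, a form in
    which common factors and symmetry are visible. *)
Definition bez_gen n f g : {poly {poly R}} := \poly_(i < n) bez_row f g i.

Lemma sum_drop_poly_gen n f : (size f <= n.+1)%N ->
  (\poly_(i < n) drop_poly i.+1 f) * ('X - 'X%:P) = f^:P - f%:P.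
Proof.
move=> sf; rewrite mulrBr; apply/polyP=> k.
rewrite coefB coefMX coefMC !coef_poly !coefB coefC.
have map_coef j : (f^:P)`_j = (f`_j)%:P.
  by rewrite coef_map.
rewrite map_coef.
case: k => [|k] /=.
  have := drop_poly_shift f 0; rewrite drop_poly0l => {3}->.
  case: ltnP => // h; first by ring.
  by rewrite (drop_poly_eq0 (leq_trans sf _)) ?ltnS //; ring.
have [lt_kn|le_nk] := ltnP k n; last first.
  rewrite ltnNge (leq_trans le_nk) //= mul0r.
  by rewrite nth_default ?subrr ?subr0 // (leq_trans sf).
have [lt_kn1|le_nk1] := ltnP k.+1 n.
  by rewrite (drop_poly_shift f k.+1); ring.
rewrite (drop_poly_shift f k.+1) (drop_poly_eq0 (m := k.+2)); first by ring.
by rewrite (leq_trans sf).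
Qed.

Lemma bez_genE n f g : (size f <= n.+1)%N -> (size g <= n.+1)%N ->
  bez_gen n f g * ('X - 'X%:P) = f^:P * g%:P - g^:P * f%:P.
Proof.
move=> sf sg.
have -> : bez_gen n f g = (\poly_(i < n) drop_poly i.+1 f) * g%:P
                        - (\poly_(i < n) drop_poly i.+1 g) * f%:P.
  apply/polyP=> k; rewrite coefB !coefMC !coef_poly /bez_row.
  by case: ltnP => // _; ring.
have F := sum_drop_poly_gen sf; have G := sum_drop_poly_gen sg.
transitivity ((\poly_(i < n) drop_poly i.+1 f) * ('X - 'X%:P) * g%:P
    - (\poly_(i < n) drop_poly i.+1 g) * ('X - 'X%:P) * f%:P); first by ring.
by rewrite F G; ring.
Qed.

Lemma bezmxE n f g (i j : 'I_n) : bezmx n f g i j = (bez_gen n f g)`_i`_j.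
Proof. by rewrite mxE coef_poly ltn_ord. Qed.

Lemma bez_rowC f g i : bez_row f g i = - bez_row g f i.
Proof. by rewrite /bez_row opprB. Qed.

(** A common factor X - s multiplies the generating polynomial by (u - s)(w - s).
    On the entries with both indices positive, that is a row and a column operation
    by the unitriangular matrix 1 - s N, where N is the nilpotent shift. *)
Lemma bezmx_XsubC n f g s : (size f <= n.+1)%N -> (size g <= n.+1)%N ->
  \det (row' ord0 (col' ord0 (bezmx n.+1 (f * ('X - s%:P)) (g * ('X - s%:P)))))
    = \det (bezmx n f g).
Proof.
move=> sf sg.
have sX h : (size h <= n.+1)%N -> (size (h * ('X - s%:P))%R <= n.+2)%N.
  move=> sh; apply: leq_trans (size_polyMleq _ _) _.
  by rewrite size_XsubC addn2.
have genX : bez_gen n.+1 (f * ('X - s%:P)) (g * ('X - s%:P))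
    = bez_gen n f g * ('X - s%:P%:P) * ('X - s%:P)%:P.
  have monX : GRing.rreg ('X - 'X%:P : {poly {poly R}}).
    exact/monic_rreg/monicXsubC.
  apply: (monX); rewrite bez_genE ?sX //.
  have -> : bez_gen n f g * ('X - s%:P%:P) * ('X - s%:P)%:P * ('X - 'X%:P)
    = bez_gen n f g * ('X - 'X%:P) * ('X - s%:P%:P) * ('X - s%:P)%:P by ring.
  rewrite bez_genE // !rmorphM !rmorphB /= map_polyX !map_polyC /=.
  by ring.
pose U : 'M[R]_n := \matrix_(i, j) (if j == i :> nat then 1
                      else if j == i.+1 :> nat then - s else 0).
have detU : \det U = 1.
  rewrite -det_tr det_trig ?big1 // => [i _|]; first by rewrite !mxE eqxx.
  apply/is_trig_mxP=> i j lt_ij; rewrite !mxE.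
  by rewrite ltn_eqF // ltn_eqF // ltnW.
pose N (i j : nat) := (bez_gen n f g)`_i`_j.
have N0l i j : (n <= i)%N -> N i j = 0.
  by move=> le_ni; rewrite /N coef_poly ltnNge le_ni coef0.
have N0r i j : (n <= j)%N -> N i j = 0.
  move=> le_nj; rewrite /N coef_poly; case: ltnP => [lt_in|]; rewrite ?coef0 //.
  by rewrite nth_default // (leq_trans (size_bez_row sf sg lt_in)).
have mulU (m : nat) (A : 'M[R]_(n, m)) (B : nat -> nat -> R) :
    (forall i j, (n <= i)%N -> B i j = 0) ->
    (forall (i : 'I_n) (j : 'I_m), A i j = B i j) ->
  forall (i : 'I_n) (j : 'I_m), (U *m A) i j = B i j - s * B i.+1 j.
  move=> B0 AB i j; rewrite mxE (bigD1 i) //= !mxE eqxx mul1r AB; congr (_ + _).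
  have [lt_i1|ge_i1] := ltnP i.+1 n; last first.
    rewrite B0 // mulr0 oppr0 big1 // => l nli.
    rewrite mxE -val_eqE in nli *; move: nli => /= /negPf->.
    by rewrite ltn_eqF ?mul0r // (leq_trans (ltn_ord l)).
  rewrite (bigD1 (Ordinal lt_i1)) /=; last by rewrite -val_eqE /= gtn_eqF.
  rewrite mxE /= gtn_eqF // eqxx AB big1 ?addr0 ?mulNr // => l /andP[nli nlk].
  move: nli nlk; rewrite -!val_eqE mxE /= => /negPf-> /negPf->.
  by rewrite mul0r.
have -> : row' ord0 (col' ord0 (bezmx n.+1 (f * ('X - s%:P)) (g * ('X - s%:P))))
          = (U *m (U *m bezmx n f g)^T)^T.
  apply/matrixP=> i j; rewrite [RHS]mxE.
  rewrite (mulU _ _ (fun j i => N i j - s * N i.+1 j)); first last.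
  - by move=> k l; rewrite mxE (mulU _ _ N) // => k' l'; rewrite bezmxE.
  - by move=> k l le_nk; rewrite !N0r // mulr0 subrr.
  rewrite mxE mxE bezmxE genX coefMC mulrBr coefB coefMX !lift0 /=.
  rewrite !mulrBr coefB coefMX !coefMC /= !coefB !coefMC.
  by rewrite /N; ring.
by rewrite det_tr !det_mulmx det_tr det_mulmx detU !mul1r.
Qed.
End BezoutMatrix.
(** * Bezout determinants and resultants *)

Lemma det_row_perm_sign (R : comNzRingType) n (s : 'S_n) (A : 'M[R]_n) :
  \det (row_perm s A) = (-1) ^+ s * \det A.
Proof. by rewrite row_permE det_mulmx det_perm. Qed.

Section BezoutResultant.
Variable R : comNzRingType.
Implicit Types f g : {poly R}.

(** Every row of the Bezout matrix is the combination f^(i) g - g^(i) f of [f] and [g], with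
    f^(i) the Horner quotients. So a triangular row transformation, whose diagonal
    entries are [lead_coef f] and 1, turns the Sylvester matrix into a block triangular
    one. One diagonal block is the Bezout matrix, and the other consists of shifts of [f]
    and is triangular too. *)
Lemma bez_resultant f g : f != 0 -> (size g <= size f)%N ->
  exists e : bool,
    lead_coef f ^+ (size f).-1 * resultant g f
      = (-1) ^+ e * lead_coef f ^+ (size g).-1 * \det (bezmx (size f).-1 f g).
Proof.
move=> f0 le_gf; pose n := (size f).-1; pose m := (size g).-1.
have sf : size f = n.+1 by rewrite prednK // lt0n size_poly_eq0.
have sg : (size g <= m.+1)%N by rewrite /m; case: (size g).
have le_mn : (m <= n)%N by rewrite /m /n; move: le_gf; lia.
rewrite -/n -/m /resultant.
pose band (r : {poly R}) k := lin1_mx (poly_rV \o r \o* @rVpoly R k) : 'M_(k, n + m).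
rewrite /Sylvester_mx -/n -/m -/(band g n) -/(band f m).
(* Reversing the order of the Bezout rows makes the blocks lower triangular. *)
pose F := \matrix_(i < n) poly_rV (drop_poly (n - i) f) : 'M_n.
pose G := \matrix_(i < n) poly_rV (drop_poly (n - i) g) : 'M_(n, m).
pose T := block_mx F (- G) 0 1%:M.
have sdf (i : 'I_n) : (size (drop_poly (n - i) f) <= n)%N.
  by rewrite size_drop_poly sf; have := ltn_ord i; lia.
have sdg (i : 'I_n) : (size (drop_poly (n - i) g) <= m)%N.
  by rewrite size_drop_poly; have := ltn_ord i; move: sg; lia.
have nS (i : 'I_n) : (n - i)%N = (rev_ord i).+1 by rewrite /= subnSK.
pose s : 'S_n := perm (@rev_ord_inj n).
pose B := row_perm s (bezmx n f g).
pose L := lsubmx (band f m); pose D := rsubmx (band f m).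
have TS : T *m col_mx (band g n) (band f m) = block_mx B 0 L D.
  rewrite mul_block_col mul0mx mul1mx add0r block_mxEv hsubmxK.
  congr col_mx; apply/row_matrixP=> i.
  rewrite mulNmx linearB /= !row_mul !rowK !mul_rV_lin1 /= !poly_rV_K //.
  rewrite -linearB /= nS -/(bez_row f g (rev_ord i)); apply/rowP=> j.
  rewrite !mxE; case: (split_ordP j) => {}j ->; rewrite !mxE ?permE //=.
  rewrite nth_default // (leq_trans (@size_bez_row _ n _ _ _ _ _ _)) //.
  - by rewrite sf.
  - by rewrite (leq_trans sg).
  - exact: (ltn_ord (rev_ord i)).
  - exact: leq_addr.
have detF : \det F = lead_coef f ^+ n.
  rewrite det_trig.
    rewrite (eq_bigr (fun=> lead_coef f)) ?prodr_const ?card_ord // => i _.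
    by rewrite !mxE coef_drop_poly subnKC ?lead_coefE // ltnW.
  apply/is_trig_mxP=> i j lt_ij; rewrite !mxE coef_drop_poly nth_default // sf.
  by have := ltn_ord i; lia.
have detD : \det D = lead_coef f ^+ m.
  rewrite det_trig.
    rewrite (eq_bigr (fun=> lead_coef f)) ?prodr_const ?card_ord // => i _.
    rewrite !mxE /= rVpoly_delta coefXnM /=.
    by rewrite ltnNge leq_addl /= addnK lead_coefE.
  apply/is_trig_mxP=> i j lt_ij; rewrite !mxE /= rVpoly_delta coefXnM.
  case: ifP => // _; rewrite nth_default // sf /=; lia.
have := congr1 determinant TS.
rewrite det_mulmx det_ublock det1 mulr1 detF det_lblock detD det_row_perm_sign.
by move=> ->; exists (odd_perm s); rewrite mulrAC.
Qed.
End BezoutResultant.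

(** The blocks are exchanged by an invertible block permutation matrix. *)
Lemma det_cast_col_mxC (R : comUnitRingType) m n k (e : (m + n)%N = k)
    (e' : (n + m)%N = k) (A : 'M[R]_(m, k)) (B : 'M[R]_(n, k)) :
  exists2 u : R, u \is a GRing.unit &
    \det (castmx (e', erefl) (col_mx B A)) = u * \det (castmx (e, erefl) (col_mx A B)).
Proof.
have castl p p' q r (h : p = p') (X : 'M[R]_(p, q)) (Y : 'M[R]_(q, r)) :
    castmx (h, erefl) X *m Y = castmx (h, erefl) (X *m Y).
  by case: _ / h.
have castm p q r r' (h : r = r') (X : 'M[R]_(p, r)) (Y : 'M[R]_(r, q)) :
    castmx (erefl, h) X *m castmx (h, erefl) Y = X *m Y.
  by case: _ / h.
case: _ / e in e' A B *; rewrite castmx_id.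
pose X := block_mx (0 : 'M[R]_(n, m)) 1%:M 1%:M 0.
pose X' := block_mx (0 : 'M[R]_(m, n)) 1%:M 1%:M 0.
pose J : 'M_(m + n) := castmx (e', erefl) X.
pose J' : 'M_(m + n) := castmx (erefl, e') X'.
have J'J : J' *m J = 1%:M.
  rewrite castm mulmx_block !(mul0mx, mulmx0, mul1mx, add0r, addr0).
  by rewrite -scalar_mx_block.
exists (\det J).
  by apply/unitrPr; exists (\det J'); rewrite mulrC -det_mulmx J'J det1.
rewrite -det_mulmx castl mul_block_col.
by rewrite !(mul0mx, mul1mx, add0r, addr0).
Qed.

(** * First-order expansion of a determinant at a singular matrix *)

Section DetFirstOrder.
Variable R : comNzRingType.

(** The adjugate of such an [A] is its first principal minor times v v^T; this is
    Jacobi's formula for the derivative of det at [A] in the direction [C]. The proof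
    completes [v] to a unimodular matrix [S] and works with S^T A S, whose first row
    and column vanish. *)
Lemma det_first_order n (A C : 'M[R]_n.+1) (v : 'cV[R]_n.+1) :
  v ord0 0 = 1 -> A *m v = 0 -> v^T *m A = 0 ->
  (\det (map_mx polyC A + 'X *: map_mx polyC C))`_1
    = (v^T *m C *m v) 0 0 * \det (row' ord0 (col' ord0 A)).
Proof.
move=> v0 Av vA.
pose S : 'M[R]_n.+1 := \matrix_(i, j) (if j == ord0 then v i 0 else (i == j)%:R).
have detS : \det S = 1.
  rewrite det_trig; first rewrite big1 // => i _.
    by rewrite mxE; case: eqP => [->|_]; rewrite ?v0 ?eqxx.
  apply/is_trig_mxP=> i j lt_ij; rewrite mxE.
  case: eqP lt_ij => [-> //|_] lt_ij; rewrite -val_eqE /=.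
  by rewrite ltn_eqF.
have colS : col 0 S = v by apply/colP=> i; rewrite !mxE eqxx.
have colSj (j : 'I_n) : col (lift ord0 j) S = delta_mx (lift ord0 j) 0.
  by apply/colP=> i; rewrite !mxE andbT.
have SE (B : 'M[R]_n.+1) :
    [/\ (S^T *m B *m S) 0 0 = (v^T *m B *m v) 0 0,
        forall j, (S^T *m B *m S) 0 (lift ord0 j) = (v^T *m B) 0 (lift ord0 j),
        forall i, (S^T *m B *m S) (lift ord0 i) 0 = (B *m v) (lift ord0 i) 0
      & forall i j, (S^T *m B *m S) (lift ord0 i) (lift ord0 j)
           = B (lift ord0 i) (lift ord0 j)].
  have rowS : row 0 S^T = v^T by rewrite -tr_col colS.
  have rowSi i : row (lift ord0 i) S^T = delta_mx 0 (lift ord0 i).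
    by rewrite -tr_col colSj trmx_delta.
  have ent i j : (S^T *m B *m S) i j = (row i S^T *m B *m col j S) 0 0.
    by rewrite colE mulmxA -row_mul -row_mul -colE [RHS]mxE [RHS]mxE.
  split=> [|j|i|i j]; rewrite ent ?rowS ?colS ?rowSi ?colSj //.
  - by rewrite -colE !mxE.
  - by rewrite -mulmxA -rowE !mxE.
  - by rewrite -colE -rowE !mxE.
pose M := map_mx polyC A + 'X *: map_mx polyC C.
pose SP := map_mx polyC S.
have -> : \det M = \det (SP^T *m M *m SP).
  by rewrite !det_mulmx det_tr det_map_mx detS !mul1r mulr1.
pose A1 := S^T *m A *m S; pose C1 := S^T *m C *m S.
have -> : SP^T *m M *m SP = map_mx polyC A1 + 'X *: map_mx polyC C1.
  rewrite /M /A1 /C1 !map_mxM -/SP map_trmx mulmxDr mulmxDl.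
  by rewrite -scalemxAr -scalemxAl.
have [A00 A0j Ai0 Aij] := SE A; have [C00 _ _ _] := SE C.
rewrite -/A1 vA Av in A00 A0j Ai0 Aij; rewrite -/C1 in C00.
clearbody A1 C1.
(* The first column is a multiple of X, because that of A1 is zero. *)
pose N := \matrix_(i, j) (if j == ord0 then (C1 i j)%:P
                          else (A1 i j)%:P + 'X * (C1 i j)%:P).
have -> : map_mx polyC A1 + 'X *: map_mx polyC C1
    = N *m diag_mx (\row_j (if j == ord0 then 'X else 1)).
  rewrite mul_mx_diag; apply/matrixP=> i j; rewrite !mxE.
  case: eqP => [->|_]; last by rewrite mulr1.
  have -> : A1 i ord0 = 0; last by rewrite add0r mulrC.
  case: (unliftP ord0 i) => [k|] ->; first by rewrite Ai0 mxE.
  by rewrite A00 mul0mx mxE.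
rewrite det_mulmx det_diag (bigD1 ord0) //= mxE eqxx big1 ?mulr1; last first.
  by move=> j /negPf nj; rewrite mxE nj.
rewrite coefMX /= -horner_coef0 -[_.[0]]/(horner_eval 0 (\det N)) -det_map_mx.
rewrite (expand_det_row _ ord0) big_ord_recl big1 ?addr0; last first.
  move=> j _; apply: etrans (mul0r _); congr (_ * _).
  by rewrite !mxE /= /horner_eval !hornerE A0j mxE.
rewrite /cofactor addn0 expr0 mul1r; congr (_ * _).
  by rewrite -C00 !mxE /= /horner_eval hornerC.
congr (\det _); apply/matrixP=> i j; rewrite !mxE /= /horner_eval !hornerE.
by rewrite Aij.
Qed.
End DetFirstOrder.
(** * The pencil of Bezout matrices of a triple of polynomials *)

Section Vec3.
Variable A : comNzRingType.
Implicit Types u v w : 'I_3 -> A.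

Definition dot u v := u 0 * v 0 + u 1 * v 1 + u 2 * v 2.

Definition cross3 u v : 'I_3 -> A :=
  fun i => u (i + 1) * v (i + 2) - u (i + 2) * v (i + 1).

Definition det3 u v w := dot u (cross3 v w).

End Vec3.

Lemma ord3P (i : 'I_3) : [\/ i = 0, i = 1 | i = 2].
Proof.
case: i => -[|[|[|//]]] h; [apply: Or31|apply: Or32|apply: Or33]; exact: val_inj.
Qed.

Lemma sum3 (V : nmodType) (F : 'I_3 -> V) : \sum_i F i = F 0 + F 1 + F 2.
Proof.
rewrite !big_ord_recl big_ord0 addr0 addrA.
by congr (F _ + F _ + F _); apply: val_inj.
Qed.

Lemma ord3_add : (((0 + 1)%R = 1 :> 'I_3) * ((0 + 2)%R = 2 :> 'I_3) *
  ((1 + 1)%R = 2 :> 'I_3) * ((1 + 2)%R = 0 :> 'I_3) * ((2 + 1)%R = 0 :> 'I_3)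
  * ((2 + 2)%R = 1 :> 'I_3))%type.
Proof. by do !split; apply: val_inj. Qed.

Section Vec3Theory.
Variable A : comNzRingType.
Implicit Types u v w : 'I_3 -> A.

Lemma det3E u v w : det3 u v w =
  u 0 * (v 1 * w 2 - v 2 * w 1) + u 1 * (v 2 * w 0 - v 0 * w 2)
  + u 2 * (v 0 * w 1 - v 1 * w 0).
Proof. by rewrite /det3 /dot /cross3 !ord3_add. Qed.

Lemma eq_det3 u u' v v' w w' : u =1 u' -> v =1 v' -> w =1 w' ->
  det3 u v w = det3 u' v' w'.
Proof. by move=> eu ev ew; rewrite !det3E !eu !ev !ew. Qed.

Lemma dot_crossr u v : dot v (cross3 u v) = 0.
Proof. by rewrite /dot /cross3 !ord3_add; ring. Qed.

End Vec3Theory.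

Section Pencil.
Variable A : comNzRingType.
Implicit Types (P : 'I_3 -> {poly A}) (Q : 'I_3 -> A) (n : nat).

(** The coefficient matrix of det(Q, P(u), P(w)) / (u - w) as a polynomial in [u]
    and [w]: a combination with coefficients Q_k of the Bezout matrices of the
    pairs (P_(k+1), P_(k+2)). *)
Definition pencil n P Q : 'M[A]_n :=
  \matrix_(i, j) dot Q (fun k => (bez_row (P (k + 1)) (P (k + 2)) i)`_j).

Lemma pencil_sum n P Q :
  pencil n P Q = \sum_k Q k *: bezmx n (P (k + 1)) (P (k + 2)).
Proof.
by apply/matrixP=> i j; rewrite sum3 !mxE.
Qed.

Lemma eq_pencil n P P' Q Q' : P =1 P' -> Q =1 Q' ->
  pencil n P Q = pencil n P' Q'.
Proof.
by move=> eP eQ; rewrite !pencil_sum; apply: eq_bigr => k _; rewrite eQ !eP.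
Qed.

Lemma pencilD n P Q Q' :
  pencil n P (fun k => Q k + Q' k) = pencil n P Q + pencil n P Q'.
Proof.
rewrite !pencil_sum -big_split; apply: eq_bigr => k _.
by rewrite /= scalerDl.
Qed.

Lemma pencilZ n P Q c :
  pencil n P (fun k => c * Q k) = c *: pencil n P Q.
Proof.
by rewrite !pencil_sum scaler_sumr; apply: eq_bigr => k _; rewrite scalerA.
Qed.

Lemma tr_bezmx n (f g : {poly A}) : (size f <= n.+1)%N -> (size g <= n.+1)%N ->
  (bezmx n f g)^T = bezmx n f g.
Proof.
move=> sf sg; have sw : swapXY (bez_gen n f g) = bez_gen n f g.
  have monX : GRing.rreg ('X - 'X%:P : {poly {poly A}}).
    exact/monic_rreg/monicXsubC.
  apply: (monX); rewrite bez_genE //.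
  have := congr1 swapXY (bez_genE sf sg).
  rewrite (rmorphM swapXY) raddfB [swapXY (_ * _ - _)]raddfB /= !(rmorphM swapXY).
  rewrite /= !swapXY_polyC !swapXY_map_polyC.
  rewrite swapXY_X map_polyX => swE.
  by rewrite -[LHS]opprK -mulrN opprB swE; ring.
by apply/matrixP=> i j; rewrite mxE !bezmxE -coef_swapXY sw.
Qed.

Lemma tr_pencil n P Q : (forall k, size (P k) <= n.+1)%N ->
  (pencil n P Q)^T = pencil n P Q.
Proof.
move=> sP; rewrite pencil_sum linear_sum /=; apply: eq_bigr => k _.
by rewrite linearZ /= tr_bezmx.
Qed.

Lemma pencil_row n P Q w (i : 'I_n) : (forall k, size (P k) <= n.+1)%N ->
  \sum_(j < n) pencil n P Q i j * w ^+ j =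
  det3 Q (fun k => (drop_poly i.+1 (P k)).[w]) (fun k => (P k).[w]).
Proof.
move=> sP; have := fun k => bez_row_horner i w (sP (k + 1)) (sP (k + 2)).
move=> rowE.
rewrite (eq_bigr (fun j : 'I_n => \sum_k
  Q k * (bezmx n (P (k + 1)) (P (k + 2)) i j * w ^+ j))); last first.
  by move=> j _; rewrite pencil_sum summxE mulr_suml;
    apply: eq_bigr => k _; rewrite mxE mulrA.
rewrite exchange_big /= (eq_bigr (fun k => Q k *
    (bez_row (P (k + 1)) (P (k + 2)) i).[w])); last first.
  by move=> k _; rewrite -mulr_sumr rowE.
rewrite sum3 !ord3_add det3E /bez_row !hornerE.
by ring.
Qed.

Definition monomial_col n w : 'cV[A]_n := \col_i w ^+ i.

Lemma pencil_powcol n P Q w : (forall k, size (P k) <= n.+1)%N ->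
  pencil n P Q *m monomial_col n w = \col_i
  det3 Q (fun k => (drop_poly i.+1 (P k)).[w]) (fun k => (P k).[w]).
Proof.
move=> sP; apply/colP=> i; rewrite !mxE -pencil_row //.
by apply: eq_bigr => j _; rewrite [monomial_col _ _ _ _]mxE.
Qed.

Lemma sum_drop_horner n (f : {poly A}) u w : (size f <= n.+1)%N ->
  (\sum_(i < n) u ^+ i * (drop_poly i.+1 f).[w]) * (u - w) = f.[u] - f.[w].
Proof.
move=> sf; have := congr1 (fun q => q.[u%:P].[w]) (sum_drop_poly_gen sf).
rewrite /= hornerM hornerXsubC hornerM !hornerE /=.
have -> : (f^:P).[u%:P].[w] = f.[u] by rewrite horner_map /= hornerC.
move=> <-; congr (_ * _); rewrite horner_poly horner_sum; apply: eq_bigr => i _.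
by rewrite -rmorphXn /= !hornerE mulrC.
Qed.

Lemma det3_sumr n (u w : 'I_3 -> A) (c : 'I_n -> A) (F : 'I_n -> 'I_3 -> A) :
  \sum_i c i * det3 u (F i) w = det3 u (fun k => \sum_i c i * F i k) w.
Proof.
have det3E' v : det3 u v w = \sum_k v k * cross3 w u k.
  by rewrite sum3 /cross3 !ord3_add det3E; ring.
rewrite det3E'; under [RHS]eq_bigr do rewrite mulr_suml.
rewrite exchange_big; apply: eq_bigr => i _ /=; rewrite det3E' mulr_sumr.
by apply: eq_bigr => k _; rewrite mulrA.
Qed.

Lemma pencil_quad n P Q u w : (forall k, size (P k) <= n.+1)%N ->
  ((monomial_col n u)^T *m pencil n P Q *m monomial_col n w) 0 0 =
  det3 Q (fun k => \sum_(i < n) u ^+ i * (drop_poly i.+1 (P k)).[w])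
         (fun k => (P k).[w]).
Proof.
move=> sP; rewrite -mulmxA pencil_powcol // -det3_sumr mxE.
by apply: eq_bigr => i _; rewrite !mxE.
Qed.

Lemma pencil_off_diag n P Q u w : (forall k, size (P k) <= n.+1)%N ->
  ((monomial_col n u)^T *m pencil n P Q *m monomial_col n w) 0 0 * (u - w) =
  det3 Q (fun k => (P k).[u]) (fun k => (P k).[w]).
Proof.
move=> sP; rewrite pencil_quad //.
have sE k := sum_drop_horner u w (sP k).
rewrite [RHS](eq_det3 (u' := Q)
  (v' := fun k => (\sum_(i < n) u ^+ i * (drop_poly i.+1 (P k)).[w]) * (u - w)
    + (P k).[w]) (w' := fun k => (P k).[w])) //; last first.
  by move=> k; rewrite sE subrK.
by rewrite !det3E; ring.
Qed.

Lemma pencil_diag n P Q w : (forall k, size (P k) <= n.+1)%N ->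
  ((monomial_col n w)^T *m pencil n P Q *m monomial_col n w) 0 0 =
  det3 Q (fun k => (P k)^`().[w]) (fun k => (P k).[w]).
Proof.
move=> sP; rewrite pencil_quad //; apply: eq_det3 => // k.
rewrite -(sum_drop_poly_deriv (sP k)) horner_sum; apply: eq_bigr => i _.
by rewrite !hornerE mulrC.
Qed.

End Pencil.

Lemma map_bez_row (A B : comNzRingType) (phi : {rmorphism A -> B}) f g i :
  map_poly phi (bez_row f g i) = bez_row (map_poly phi f) (map_poly phi g) i.
Proof.
have mapd (h : {poly A}) : map_poly phi (drop_poly i.+1 h)
    = drop_poly i.+1 (map_poly phi h).
  by apply/polyP=> j; rewrite !(coef_map, coef_drop_poly).
by rewrite /bez_row rmorphB !rmorphM /= !mapd.
Qed.

Lemma map_pencil (A B : comNzRingType) (phi : {rmorphism A -> B}) n P Q :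
  map_mx phi (pencil n P Q) = pencil n (fun k => map_poly phi (P k)) (phi \o Q).
Proof.
apply/matrixP=> i j; rewrite !mxE /dot /= !rmorphD !rmorphM /=.
by rewrite -!map_bez_row !coef_map.
Qed.

Definition lift_curve (K : comNzRingType) (P : 'I_3 -> {poly K}) :
    'I_3 -> {poly {poly K}} :=
  fun k => (P k)^:P.

Section Gradient.
Variables (K : comNzRingType) (n : nat) (P : 'I_3 -> {poly K}).
Hypothesis sP : (forall k, size (P k) <= n.+2)%N.

(** Here the vector [Q] runs along the curve itself: the coefficient ring is K[s] and
    [Q] is P(s). *)
Definition curve_pencil : 'M[{poly K}]_n.+1 := pencil n.+1 (lift_curve P) P.

(** This minor carries the adjugate of the singular matrix [curve_pencil]. Up to
    a constant it is the T-function, and also the quotient of the gradient of the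
    implicit form along the curve by the cross product of P' and P. *)
Definition pencil_minor : {poly K} := \det (row' ord0 (col' ord0 curve_pencil)).

Lemma size_lift k : (size (lift_curve P k) <= n.+2)%N.
Proof. by rewrite (leq_trans (size_poly _ _)). Qed.

Lemma lift_polyX k : (lift_curve P k).['X] = P k.
Proof. by rewrite /lift_curve -/(_ \Po _) comp_polyXr. Qed.

(** The i-th entry of the product is det(P(s), P^(i)(s), P(s)), where P^(i) collects
    the i-th Horner quotients of the components. *)
Lemma curve_pencil_ker : curve_pencil *m monomial_col n.+1 'X = 0.
Proof.
rewrite pencil_powcol; last exact: size_lift.
by apply/colP=> i; rewrite !mxE det3E !lift_polyX; ring.
Qed.

Lemma tr_curve_pencil : curve_pencil^T = curve_pencil.
Proof. exact: tr_pencil size_lift. Qed.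

(** By [det_first_order] the derivative of the determinant in the direction [b] is the
    minor times the value of the pencil of [b], as a quadratic form, at the kernel
    vector (1, s, s^2, ...); that value is det(b, P', P) by [pencil_diag]. *)
Lemma pencil_gradient (b : 'I_3 -> {poly K}) :
  (\det (pencil n.+1 (fun k => map_poly polyC (lift_curve P k))
          (fun k => (P k)%:P + 'X * (b k)%:P)))`_1
    = det3 b (fun k => (P k)^`()) P * pencil_minor.
Proof.
have -> : pencil n.+1 (fun k => map_poly polyC (lift_curve P k))
     (fun k => (P k)%:P + 'X * (b k)%:P)
   = map_mx polyC curve_pencil + 'X *: map_mx polyC (pencil n.+1 (lift_curve P) b).
  by rewrite pencilD pencilZ !map_pencil.
rewrite (@det_first_order _ _ _ _ (monomial_col n.+1 'X)).
- rewrite pencil_diag; last exact: size_lift.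
  congr (_ * _); apply: eq_det3 => // k; last exact: lift_polyX.
  by rewrite /lift_curve deriv_map -/(lift_curve _ _) /= -/(_ \Po _) comp_polyXr.
- by rewrite mxE expr0.
- exact: curve_pencil_ker.
- by rewrite -[X in _ *m X]trmxK -trmx_mul tr_curve_pencil curve_pencil_ker trmx0.
Qed.

End Gradient.
(** * The T-function as a minor of the pencil *)

Lemma resultantC (R : comUnitRingType) (f g : {poly R}) :
  exists2 u : R, u \is a GRing.unit & resultant f g = u * resultant g f.
Proof.
pose band (r : {poly R}) k l := lin1_mx (poly_rV \o r \o* @rVpoly R k) : 'M_(k, l).
pose a := (size f).-1; pose b := (size g).-1.
have castM k l (e : k = l) (M : 'M[R]_k) : \det (castmx (e, e) M) = \det M.
  by case: _ / e.
have [u Uu du] := det_cast_col_mxC (erefl (a + b)%N) (addnC b a)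
  (band g a (a + b)%N) (band f b (a + b)%N).
exists u => //.
rewrite castmx_id in du; rewrite /resultant -[X in u * \det X]/(col_mx _ _) -du.
rewrite -(castM _ _ (addnC b a)); congr (\det _).
by rewrite /Sylvester_mx -/a -/b; case: _ / (addnC b a).
Qed.

Lemma bezmxN (R : comNzRingType) n (f g : {poly R}) : bezmx n f g = - bezmx n g f.
Proof. by apply/matrixP=> i j; rewrite !mxE bez_rowC coefN. Qed.

Lemma detN_unit (R : comUnitRingType) n (M : 'M[R]_n) :
  exists2 u : R, u \is a GRing.unit & \det (- M) = u * \det M.
Proof.
by exists ((-1) ^+ n); rewrite ?unitrX ?unitrN1 // -scaleN1r detZ.
Qed.

Section BezoutPoly.
Variable K : fieldType.
Implicit Types (f g : {poly {poly K}}) (q : {poly K}).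

Lemma poly_unitP q : q \is a GRing.unit -> exists2 c : K, c != 0 & q = c%:P.
Proof.
rewrite poly_unitE => /andP[/size_poly1P[c c0 ->] _]; by exists c.
Qed.

(** If the degrees differ, the surplus power of the leading coefficient of [f] is a
    power of [q] up to a constant; if they agree, there is no surplus. *)
Lemma bez_resultant_lc n f g q :
  size f = n.+1 -> (size g <= n.+1)%N ->
  ((size g < n.+1)%N -> exists2 k : K, k != 0 & lead_coef f = k *: q) ->
  exists2 c : K, c != 0 &
    \det (bezmx n f g) = c *: (q ^+ (n - (size g).-1) * resultant g f).
Proof.
move=> sf sg lcf; have f0 : f != 0 by rewrite -size_poly_eq0 sf.
have le_gf : (size g <= size f)%N by rewrite sf.
have [e] := bez_resultant f0 le_gf; rewrite sf /=.
set m := (size g).-1.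
have le_mn : (m <= n)%N by rewrite /m; move: sg; lia.
rewrite -{1}(subnK le_mn) exprD -mulrA [_ * (lead_coef f ^+ m * _)]mulrCA.
rewrite [_ ^+ e * _]mulrC -[X in _ = X]mulrA.
have lc0 : lead_coef f ^+ m != 0 by rewrite expf_neq0 ?lead_coef_eq0.
move/(mulfI lc0) => eqd.
have {}eqd : \det (bezmx n f g) = (-1) ^+ e * (lead_coef f ^+ (n - m) * resultant g f).
  by rewrite eqd mulrA -expr2 sqrr_sign mul1r.
have [lt_gn|ge_gn] := ltnP (size g) n.+1; last first.
  exists ((-1) ^+ e); first by rewrite signr_eq0.
  rewrite eqd.
  have -> : (n - m)%N = 0%N by apply/eqP; rewrite subn_eq0 /m; move: ge_gn; lia.
  by rewrite !expr0 !mul1r -mul_polyC rmorphXn /= rmorphN1.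
have [k k0 lcE] := lcf lt_gn.
exists ((-1) ^+ e * k ^+ (n - m)).
  by rewrite mulf_neq0 ?signr_eq0 // expf_neq0.
rewrite eqd lcE exprZn -!mul_polyC !rmorphM !rmorphXn /= rmorphN1.
by rewrite !mulrA.
Qed.

End BezoutPoly.

Section TFunction.
Variables (K : closedFieldType) (n : nat) (p1 p2 p : {poly K}).
Let P : 'I_3 -> {poly K} := fun k => tnth [tuple p1; p2; p] k.
Hypothesis sP : forall k, (size (P k) <= n.+2)%N.

(** Over the coefficients p1(s), p2(s), p(s), the polynomial G_1 is a combination of
    p1(t) and p(t), and G_2 of p2(t) and p(t). Expanding the Bezout form bilinearly, the
    term in p(t) and p(t) drops out, and p(s) factors out of the others. *)
Lemma bez_row_cross i :
  bez_row (cross p1 p) (cross p2 p) i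
   = p%:P * (p1%:P * bez_row (p2^:P) (p^:P) i + p2%:P * bez_row (p^:P) (p1^:P) i
      + p%:P * bez_row (p1^:P) (p2^:P) i).
Proof.
have dC (c : {poly K}) (f : {poly {poly K}}) :
    drop_poly i.+1 (c%:P * f) = c%:P * drop_poly i.+1 f.
  by rewrite !mul_polyC drop_polyZ.
have dB (f g : {poly {poly K}}) :
    drop_poly i.+1 (f - g) = drop_poly i.+1 f - drop_poly i.+1 g.
  by rewrite -[- g]scaleN1r drop_polyD drop_polyZ scaleN1r.
by rewrite /bez_row /cross !dB !dC; ring.
Qed.

Lemma bezmx_cross : bezmx n.+1 (cross p1 p) (cross p2 p) = p *: curve_pencil n P.
Proof.
apply/matrixP=> i j; rewrite !mxE bez_row_cross coefCM; congr (_ * _).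
rewrite !coefD !coefCM /dot /lift_curve !ord3_add /P.
by rewrite !(tnth_nth 0) /=.
Qed.

Lemma size_cross (f g : {poly K}) : (size (cross f g) <= maxn (size f) (size g))%N.
Proof.
rewrite (leq_trans (size_polyD _ _)) // size_polyN !mul_polyC geq_max.
by rewrite !(leq_trans (size_scale_leq _ _)) // leq_max size_map_polyC leqnn ?orbT.
Qed.

Lemma cross_star (f g : {poly K}) : cross f g = star (cross f g) * ('X - 'X%:P).
Proof.
have : root (cross f g) 'X.
  by rewrite /root /cross !hornerE -!/(_ \Po _) !comp_polyXr mulrC subrr.
case/factor_theorem=> q def_q; rewrite /star {2}def_q.
by rewrite Pdiv.IdomainMonic.mulpK ?monicXsubC.
Qed.

Lemma pencil_minor_star (size_g1 : (size (star (cross p1 p)) <= n.+1)%N)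
    (size_g2 : (size (star (cross p2 p)) <= n.+1)%N) :
  p ^+ n * pencil_minor n P = \det (bezmx n (star (cross p1 p)) (star (cross p2 p))).
Proof.
rewrite -(bezmx_XsubC 'X) // -!cross_star bezmx_cross /pencil_minor -detZ.
by congr (\det _); apply/matrixP=> i j; rewrite !mxE.
Qed.

Hypothesis p0 : p != 0.
Hypothesis size_G1 : size (cross p1 p) = maxn (size p1) (size p).
Hypothesis size_G2 : size (cross p2 p) = maxn (size p2) (size p).
Hypothesis maxP : exists k, size (P k) = n.+2.

(** Let m + 1 be the smaller degree in t of G_1 and G_2. If it is less than n + 1, then [p]
    does not attain the maximal degree, and the leading coefficient of the other
    polynomial is a constant times [p]. This accounts for the difference between p^n in
    [pencil_minor_star] and p^m in the T-function. *)
Lemma T_function_minor : exists2 c : K, c != 0 &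
  T_function p1 p2 p = tofrac (c *: pencil_minor n P).
Proof.
have sz f : size (cross f p) = maxn (size f) (size p) ->
    size (star (cross f p)) = (maxn (size f) (size p)).-1.
  move=> sG; have := congr1 (fun q : {poly {poly K}} => size q) (cross_star f p).
  have G0 : cross f p != 0.
    by rewrite -size_poly_eq0 sG -lt0n leq_max [in X in _ || X]lt0n size_poly_eq0 p0 orbT.
  have g0 : star (cross f p) != 0.
    by apply: contraNneq G0 => g0; rewrite cross_star g0 mul0r.
  by rewrite size_Mmonic ?monicXsubC // size_XsubC addn2 sG /= => ->.
have sP0 : (size p1 <= n.+2)%N by exact: (sP 0).
have sP1 : (size p2 <= n.+2)%N by exact: (sP 1).
have sP2 : (size p <= n.+2)%N by exact: (sP 2).
have sg1 := sz _ size_G1; have sg2 := sz _ size_G2.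
have lcE f : size (cross f p) = maxn (size f) (size p) -> (size p < size f)%N ->
    exists2 k : K, k != 0 & lead_coef (star (cross f p)) = k *: p.
  move=> sG lt_pf; exists (- lead_coef f).
    by rewrite oppr_eq0 lead_coef_eq0 -size_poly_eq0; apply: contraTneq lt_pf => ->.
  have -> : lead_coef (star (cross f p)) = lead_coef (cross f p).
    by rewrite [in RHS]cross_star lead_coef_Mmonic ?monicXsubC.
  rewrite lead_coefE sG (maxn_idPl (ltnW lt_pf)) /cross coefB !coefCM.
  rewrite !coef_map /= [p`_ _]nth_default; last by rewrite -ltnS (ltn_predK lt_pf).
  by rewrite polyC0 mulr0 add0r mulrC -lead_coefE mul_polyC scaleNr.
pose m := (minn (size (star (cross p1 p))) (size (star (cross p2 p)))).-1.
have le_mn : (m <= n)%N.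
  by rewrite /m sg1 sg2; move: sP0 sP1 sP2; clear; lia.
have key :
    (exists2 c : K, c != 0 &
       p ^+ n * pencil_minor n P = c *: (p ^+ (n - m) * R12 p1 p2 p)) ->
    exists2 c : K, c != 0 & T_function p1 p2 p = tofrac (c *: pencil_minor n P).
  case=> c c0; rewrite -{1}(subnK le_mn) exprD -mulrA scalerAr.
  have pX0 k : p ^+ k != 0 by rewrite expf_neq0.
  move/(mulfI (pX0 _)) => eqT; exists c^-1; first by rewrite invr_eq0.
  rewrite /T_function.
  have -> : R12 p1 p2 p = p ^+ m * (c^-1 *: pencil_minor n P).
    by rewrite -scalerAr eqT scalerA mulVf // scale1r.
  have -> : (lambda12 p1 p2 p - 1)%N = m.
    rewrite /lambda12 /G1 /G2 /m sg1 sg2 size_G1 size_G2.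
    by have := p0; rewrite -size_poly_gt0; clear; lia.
  by rewrite rmorphM rmorphXn /= mulrAC divff ?mul1r // expf_neq0 // tofrac_eq0.
apply: key; rewrite pencil_minor_star; last 2 first.
- by rewrite sg1; move: sP0 sP2; clear; lia.
- by rewrite sg2; move: sP1 sP2; clear; lia.
have maxE : (maxn (maxn (size p1) (size p)) (maxn (size p2) (size p)) = n.+2)%N.
  have : [\/ size p1 = n.+2, size p2 = n.+2 | size p = n.+2].
    case: maxP => k; case: (ord3P k) => -> sk.
    - by apply: Or31; exact: sk.
    - by apply: Or32; exact: sk.
    - by apply: Or33; exact: sk.
  by case; move: sP0 sP1 sP2; clear; lia.
have [le_ab|lt_ba] := leqP (maxn (size p1) (size p)) (maxn (size p2) (size p)).
  rewrite bezmxN.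
  have [u /poly_unitP[cu cu0 ->] ->] := detN_unit
    (bezmx n (star (cross p2 p)) (star (cross p1 p))).
  have [| | |c c0 ->] := @bez_resultant_lc _ n
    (star (cross p2 p)) (star (cross p1 p)) p.
  - by rewrite sg2; move: maxE le_ab; clear; lia.
  - by rewrite sg1; move: maxE le_ab; clear; lia.
  - rewrite sg1 => lt1; apply: lcE => //; move: maxE le_ab lt1; clear; lia.
  exists (cu * c); first by rewrite mulf_neq0.
  rewrite mul_polyC scalerA; congr (_ *: (p ^+ (n - _) * _)).
  by rewrite /m sg1 sg2; move: le_ab; clear; lia.
have [| | |c c0 ->] := @bez_resultant_lc _ n
    (star (cross p1 p)) (star (cross p2 p)) p.
- by rewrite sg1; move: maxE lt_ba; clear; lia.
- by rewrite sg2; move: maxE lt_ba; clear; lia.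
- rewrite sg2 => lt1; apply: lcE => //; move: maxE lt_ba lt1; clear; lia.
have [u /poly_unitP[cu cu0 ->] ->] := resultantC
    (star (cross p2 p)) (star (cross p1 p)).
exists (c * cu); first by rewrite mulf_neq0.
rewrite mul_polyC -!scalerAr scalerA /R12 /G1 /G2.
congr (_ *: (p ^+ (n - _) * _)).
by rewrite /m sg1 sg2; move: lt_ba; clear; lia.
Qed.

End TFunction.
(** * Parallel vectors and evaluation of forms *)

Section Parallel.
Variable K : fieldType.
Implicit Types u v w a b : 'I_3 -> K.

Definition par u v := forall i j, u i * v j = u j * v i.

Lemma parP u v : reflect (par u v) [forall i, forall j, u i * v j == u j * v i].
Proof.
apply: (iffP forallP) => [h i j|h i]; first by have /forallP/(_ j)/eqP := h i.
by apply/forallP=> j; rewrite h.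
Qed.

Lemma par_cross u v : (forall k, cross3 u v k = 0) -> par u v.
Proof.
move=> h; have := (h 0, h 1, h 2); rewrite /cross3 !ord3_add => -[[]].
move=> /eqP; rewrite subr_eq0 => /eqP e0 /eqP; rewrite subr_eq0 => /eqP e1.
move=> /eqP; rewrite subr_eq0 => /eqP e2 i j.
by case: (ord3P i) (ord3P j) => -> [] ->.
Qed.

Lemma cross_par u v : par u v -> forall k, cross3 u v k = 0.
Proof. by move=> h k; rewrite /cross3 h subrr. Qed.

Lemma par_sym u v : par u v -> par v u.
Proof. by move=> h i j; rewrite mulrC -h mulrC. Qed.

Lemma par_scale u v j : v j != 0 -> par u v -> forall i, u i = (u j / v j) * v i.
Proof. by move=> vj h i; rewrite mulrAC -(h i j) mulfK. Qed.

Lemma par_trans u v w j : v j != 0 -> par u v -> par v w -> par u w.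
Proof.
move=> vj uv vw i k; rewrite (par_scale vj uv i) (par_scale vj uv k).
by rewrite -!mulrA vw.
Qed.

Lemma notpar_cross u v : ~ par u v -> exists k, cross3 u v k != 0.
Proof.
move=> npar; apply/existsP; apply: contra_notT npar.
rewrite negb_exists => /forallP h; apply: par_cross => k; apply/eqP.
by have := h k; rewrite negbK.
Qed.

Lemma orth_par a b u : dot a u = 0 -> dot b u = 0 -> par u (cross3 a b).
Proof.
move=> au bu.
have e01 : u 0 * cross3 a b 1 - u 1 * cross3 a b 0 = a 2 * dot b u - b 2 * dot a u.
  by rewrite /dot /cross3 !ord3_add; ring.
have e12 : u 1 * cross3 a b 2 - u 2 * cross3 a b 1 = a 0 * dot b u - b 0 * dot a u.
  by rewrite /dot /cross3 !ord3_add; ring.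
have e20 : u 2 * cross3 a b 0 - u 0 * cross3 a b 2 = a 1 * dot b u - b 1 * dot a u.
  by rewrite /dot /cross3 !ord3_add; ring.
move: e01 e12 e20; rewrite au bu !mulr0 !subrr => /eqP; rewrite subr_eq0.
move=> /eqP e01 /eqP; rewrite subr_eq0 => /eqP e12 /eqP; rewrite subr_eq0.
by move=> /eqP e20 i j; case: (ord3P i) (ord3P j) => -> [] ->.
Qed.

Lemma plane_decomp a b p : ~ par a b -> ~ par p b -> det3 p a b = 0 ->
  exists k l, k != 0 /\ forall i, p i = k * a i + l * b i.
Proof.
move=> nab npb d0.
have [j wj] := notpar_cross nab.
have pb : par (cross3 p b) (cross3 a b).
  apply: orth_par; last exact: dot_crossr.
  have -> : dot a (cross3 p b) = - det3 p a b.
    by rewrite /det3 /dot /cross3 !ord3_add; ring.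
  by rewrite d0 oppr0.
pose k := cross3 p b j / cross3 a b j.
have eqk := par_scale wj pb; rewrite -/k in eqk.
have k0 : k != 0.
  apply: contra_notN npb => /eqP k0; apply: par_cross => i.
  by rewrite eqk k0 mul0r.
have [l lE] : exists l, forall i, p i - k * a i = l * b i.
  have [i0 bi0] : exists i, b i != 0.
    apply/existsP; apply: contra_notT npb; rewrite negb_exists => /forallP b0.
    by move=> i j'; have := b0 i; have := b0 j'; rewrite !negbK =>
      /eqP-> /eqP->; rewrite !mulr0.
  exists ((p i0 - k * a i0) / b i0); apply: par_scale => //.
  apply: par_cross => i; have := eqk i; rewrite /cross3 => e.
  transitivity (p (i + 1) * b (i + 2) - p (i + 2) * b (i + 1)
    - k * (a (i + 1) * b (i + 2) - a (i + 2) * b (i + 1))); first by ring.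
  by rewrite e subrr.
by exists k, l; split=> // i; rewrite -lE addrC subrK.
Qed.

End Parallel.

Section MpolyEval.

Lemma mmap_homog (R : nzRingType) (S : comNzRingType) n (phi : {rmorphism R -> S}) D
    (F : {mpoly R[n]}) (c : S) (Q : 'I_n -> S) :
  F \is D.-homog -> mmap phi (fun k => c * Q k) F = c ^+ D * mmap phi Q F.
Proof.
move=> /dhomogP hF; rewrite /mmap mulr_sumr; apply: eq_big_seq => m /hF /= dm.
rewrite mulrCA; congr (_ * _); rewrite /mmap1.
under eq_bigr do rewrite exprMn.
by rewrite big_split /= prodrXr -mdegE dm.
Qed.

Lemma map_mmap (R : nzRingType) (S T : comNzRingType) n (phi : {rmorphism R -> S})
   (psi : {rmorphism S -> T}) (F : {mpoly R[n]}) (Q : 'I_n -> S) :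
  psi (mmap phi Q F) = mmap (psi \o phi) (psi \o Q) F.
Proof.
rewrite /mmap rmorph_sum; apply: eq_bigr => m _; rewrite rmorphM /=.
by congr (_ * _); rewrite /mmap1 rmorph_prod; apply: eq_bigr => i _; rewrite rmorphXn.
Qed.

Lemma eq_mmap (R : nzRingType) (S : comNzRingType) n (phi psi : R -> S)
    (Q Q' : 'I_n -> S) (F : {mpoly R[n]}) :
  phi =1 psi -> Q =1 Q' -> mmap phi Q F = mmap psi Q' F.
Proof.
move=> ep eQ; rewrite /mmap; apply: eq_bigr => m _; rewrite ep.
by congr (_ * _); apply: mmap1_eq.
Qed.

Variable K : closedFieldType.

(** Kronecker substitution: X_i := X^(N^i) is injective on the monomials of degree
    less than N, so it maps a nonzero form to a nonzero univariate polynomial. *)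
Lemma mpoly3_nonzero_eval (F : {mpoly K[3]}) : F != 0 -> exists v, F.@[v] != 0.
Proof.
move=> F0; pose N := msize F.
pose e (m : 'X_{1..3}) := (m 0%R + N * (m 1%R + N * m 2%:R))%N.
have e_inj : {in msupp F &, injective e}.
  move=> m m' Fm Fm' em.
  have lt (m1 : 'X_{1..3}) i : m1 \in msupp F -> (m1 i < N)%N.
    move=> /msize_mdeg_lt; apply: leq_ltn_trans.
    by rewrite mdegE (bigD1 i) //= leq_addr.
  have N0 : (0 < N)%N by apply: leq_ltn_trans (lt m 0 Fm).
  have dig a b c d : (a < N)%N -> (c < N)%N -> (a + N * b = c + N * d)%N -> a = c /\ b = d.
    move=> la lc eab; have := edivn_eq d lc.
    rewrite addnC mulnC -eab addnC mulnC edivn_eq // => -[-> ->]; by [].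
  have [] := dig _ _ _ _ (lt m 0 Fm) (lt m' 0 Fm') em.
  move=> e0 /(dig _ _ _ _ (lt m 1 Fm) (lt m' 1 Fm'))[e1 e2].
  by apply/mnmP=> i; case: (ord3P i) => ->.
pose q := \sum_(m <- msupp F) F@_m *: 'X^(e m).
have [m Fm] : exists m, m \in msupp F.
  by exists (mlead F); rewrite mlead_supp.
have q0 : q != 0.
  apply/eqP=> q0; have := congr1 (fun u : {poly K} => u`_(e m)) q0.
  rewrite coef0 coef_sum (bigD1_seq m) //= coefZ coefXn eqxx mulr1.
  rewrite big_seq_cond big1 ?addr0; last first.
    move=> m' /andP[Fm' nm]; rewrite coefZ coefXn; case: eqP => [em|_].
      by rewrite (e_inj _ _ Fm Fm' em) eqxx in nm.
    by rewrite mulr0.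
  by apply/eqP; rewrite -mcoeff_msupp.
have /closed_nonrootP[x qx] := q0.
exists (fun i : 'I_3 => x ^+ (N ^ i)); apply: contraNneq qx => Fx.
rewrite /root -Fx /q horner_sum /meval /mmap; apply/eqP; apply: eq_bigr => m' _.
rewrite !hornerE /= /mmap1; congr (_ * _).
rewrite !big_ord_recl big_ord0 mulr1 -!exprM -!exprD /e; congr (_ ^+ _).
rewrite expn0 expn1 mul1n mulnDr.
have -> : lift ord0 ord0 = 1 :> 'I_3 by apply: val_inj.
have -> : lift ord0 (lift ord0 ord0) = 2 :> 'I_3 by apply: val_inj.
by rewrite -[X in (N ^ X)%N]/2%N -mulnn mulnA.
Qed.

End MpolyEval.
(** * Intersection with a generic line through a point *)

Section ClosedFieldPoly.
Variable K : closedFieldType.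
Implicit Types f g : {poly K}.

Lemma uniq_roots_deriv (rs : seq K) :
  {in rs, forall z, (\prod_(w <- rs) ('X - w%:P))^`().[z] != 0} -> uniq rs.
Proof.
elim: rs => //= z rs IH h; apply/andP; split.
  have := h z (mem_head _ _); rewrite big_cons derivM derivXsubC mul1r.
  by rewrite !hornerE subrr mul0r addr0 -[_ == 0]/(root _ z) root_prod_XsubC.
apply: IH => w rs_w; have := h w (mem_behead (s := z :: rs) rs_w).
rewrite big_cons derivM derivXsubC mul1r !hornerE.
have -> : (\prod_(w0 <- rs) ('X - w0%:P)).[w] = 0.
  by apply/eqP; rewrite -/(root _ _) root_prod_XsubC.
by rewrite add0r mulf_eq0 => /norP[].
Qed.

Lemma distinct_roots f : f != 0 ->
  (forall z, root f z -> f^`().[z] != 0) ->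
  exists rs : seq K, [/\ uniq rs, size rs = (size f).-1 & forall z, (z \in rs) = root f z].
Proof.
move=> f0 sep; have [rs def_f] := closed_field_poly_normal f.
have lc0 : lead_coef f != 0 by rewrite lead_coef_eq0.
have rootE z : (z \in rs) = root f z.
  by rewrite def_f rootZ // root_prod_XsubC.
exists rs; split=> //; last by rewrite def_f size_scale // size_prod_XsubC.
apply: uniq_roots_deriv => z; rewrite rootE => /sep.
by rewrite {1}def_f derivZ hornerZ mulf_eq0 => /norP[].
Qed.

Lemma deriv_eq0_char0 (charK : [pchar K] =i pred0) f : f^`() = 0 -> (size f <= 1)%N.
Proof.
move=> f'0; apply/leq_sizeP => -[//|j] _.
have /eqP := congr1 (fun q : {poly K} => q`_j) f'0.
rewrite coef_deriv coef0 -mulr_natr mulf_eq0 => /orP[/eqP //|].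
by rewrite (iffLR (pcharf0P K) charK).
Qed.

End ClosedFieldPoly.

(** The component [kap i] divides the product of its derivative with [kap j] for all j.
    As the components are coprime, it divides its derivative, which is therefore zero. *)
Lemma par_poly_const (K : closedFieldType) (charK : [pchar K] =i pred0)
    (kap : 'I_3 -> {poly K}) :
  (forall t, exists k, (kap k).[t] != 0) ->
  (forall i j, kap i * (kap j)^`() = kap j * (kap i)^`()) ->
  forall i, (size (kap i) <= 1)%N.
Proof.
move=> cop wr i; pose g := gcdp (gcdp (kap 0) (kap 1)) (kap 2).
have g1 : size g == 1%N.
  apply: contraT => /closed_rootP[z]; rewrite !root_gcd => /andP[/andP[z0 z1] z2].
  have [k] := cop z; case: (ord3P k) => ->; 
    by [rewrite (rootP z0) eqxx | rewrite (rootP z1) eqxx | rewrite (rootP z2) eqxx].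
have dv j : kap i %| (kap i)^`() * kap j.
  by rewrite mulrC -wr dvdp_mulr.
have : kap i %| (kap i)^`() * g.
  rewrite (eqp_dvdr _ (mulp_gcdr _ _ _)) dvdp_gcd dv andbT.
  by rewrite (eqp_dvdr _ (mulp_gcdr _ _ _)) dvdp_gcd !dv.
rewrite size_poly_eq1 in g1; rewrite (eqp_dvdr _ (eqp_mull _ g1)) mulr1.
have [k0|k0] := eqVneq (kap i)^`() 0; first by move=> _; apply: deriv_eq0_char0.
move/(dvdp_leq k0); rewrite leqNgt lt_size_deriv //.
by apply: contraNneq k0 => ->; rewrite deriv0.
Qed.

Section LinearForm.
Variable K : closedFieldType.

Definition lform (c : 'I_3 -> K) : {mpoly K[3]} := \sum_k c k *: 'X_k.

Lemma lform_eval c (v : 'I_3 -> K) : (lform c).@[v] = dot v c.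
Proof.
rewrite /lform rmorph_sum /= sum3 /dot !mevalZ !mevalXU.
by ring.
Qed.

Lemma lform_neq0 c k : c k != 0 -> lform c != 0.
Proof.
move=> ck; apply: contraNneq ck => l0.
have := lform_eval c (fun i => (i == k)%:R); rewrite l0 meval0 /dot.
by case: (ord3P k) => -> /=; rewrite ?(mul0r, mul1r, addr0, add0r) => <-.
Qed.

End LinearForm.

Lemma center_orth (K : fieldType) (P : 'I_3 -> {poly K}) (x : 'I_3 -> K) H kap :
  (forall k, cross3 P (polyC \o x) k = H * kap k) -> H != 0 ->
  dot (polyC \o x) kap = 0.
Proof.
move=> HX H0; apply: (mulfI H0); rewrite mulr0.
transitivity (dot (polyC \o x) (fun k => H * kap k)); first by rewrite /dot; ring.
by rewrite -[RHS](dot_crossr P (polyC \o x)) /dot !HX.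
Qed.

Section GenericRoots.
Variables (K : closedFieldType) (charK : [pchar K] =i pred0).
Variables (d : nat) (P : 'I_3 -> {poly K}) (x : 'I_3 -> K).
Hypothesis sP : forall k, (size (P k) <= d.+1)%N.
Variables (H : {poly K}) (kap : 'I_3 -> {poly K}).
Hypothesis HX : forall k, cross3 P (polyC \o x) k = H * kap k.
Hypothesis cop : forall t, exists k, (kap k).[t] != 0.
Hypothesis notlim : ~ par (fun k => (P k)`_d) x.

Let h := (size H).-1.

(** By the choice of [kap], det(x, Q, P) is [H * pencil_poly Q] up to sign. So the roots
    of this polynomial are the parameters of the points of the curve, other than
    [x], on the line that joins [x] and [Q]. *)
Definition pencil_poly (Q : 'I_3 -> K) : {poly K} := dot (polyC \o Q) kap.

Let PLx := cross3 (fun k => (P k)`_d) x.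

Let size_X k : (size (H * kap k)%R <= d.+1)%N.
Proof.
rewrite -HX /cross3 (leq_trans (size_polyD _ _)) // size_polyN geq_max /=.
by rewrite ![_ * _%:P]mulrC !mul_polyC !(leq_trans (size_scale_leq _ _)).
Qed.

Let coef_X k : (H * kap k)`_d = PLx k.
Proof. by rewrite -HX /PLx /cross3 coefB /= !coefMC. Qed.

Lemma size_pencil_poly Q : dot Q PLx != 0 -> (size (pencil_poly Q)) = (d - h).+1.
Proof.
move=> QL; have HQ : H * pencil_poly Q = dot (polyC \o Q) (fun k => H * kap k).
  by rewrite /pencil_poly /dot; ring.
have cd : (H * pencil_poly Q)`_d = dot Q PLx.
  by rewrite HQ /dot /= !coefD !coefCM !coef_X.
have sz : size (H * pencil_poly Q) = d.+1.
  apply/eqP; rewrite eqn_leq; apply/andP; split; last first.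
    by rewrite ltnNge; apply: contra_neqN QL => le_d; rewrite -cd nth_default.
  rewrite HQ /dot /= !mul_polyC (leq_trans (size_polyD _ _)) // geq_max.
  rewrite (leq_trans (size_polyD _ _)) ?geq_max;
    by rewrite !(leq_trans (size_scale_leq _ _)).
have nz : H * pencil_poly Q != 0 by rewrite -size_poly_eq0 sz.
move: (nz); rewrite mulf_eq0 => /norP[H0 p0]; move: sz; rewrite size_mul //.
rewrite -size_poly_gt0 in H0; rewrite -size_poly_gt0 in p0; move: H0 p0; rewrite /h.
by set a := size H; set b := size (pencil_poly Q); clearbody a b; clear; lia.
Qed.

(** Assume d > h, and say that a parameter is bad if [H], [N] or a nonzero component [W] of
    the cross product of kap and kap' vanishes there. At a double root of
    [pencil_poly Q] the vectors kap and kap' are both orthogonal to [Q] and [x], hence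
    parallel, so double roots are bad. The form [E] is not zero at [Q] if and only if
    [Q] is not on the line that joins [x] to the limit point and no root of
    [pencil_poly Q] is bad. *)
Lemma generic_roots (N : {poly K}) : N != 0 ->
  exists2 E : {mpoly K[3]}, E != 0 & forall Q, E.@[Q] != 0 ->
   exists ts : seq K, [/\ uniq ts, size ts = (d - h)%N &
     {in ts, forall t, [/\ N.[t] != 0, (pencil_poly Q)^`().[t] != 0 &
       exists k l, k != 0 /\ forall i, (P i).[t] = k * Q i + l * x i]}].
Proof.
move=> N0; have [dh0|dh_gt0] := posnP (d - h).
  exists 1; rewrite ?oner_eq0 // => Q _; exists [::]; by rewrite dh0.
have [L0 PL0] := notpar_cross notlim; rewrite -/PLx in PL0.
have H0 : H != 0.
  by apply: contraNneq PL0 => H0; rewrite -coef_X H0 mul0r coef0.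
have [W W0 Wdef] : exists2 W : {poly K}, W != 0 &
    exists j, W = cross3 kap (fun k => (kap k)^`()) j.
  suff [j Wj] : exists j, cross3 kap (fun k => (kap k)^`()) j != 0.
    by exists (cross3 kap (fun k => (kap k)^`()) j) => //; exists j.
  apply/existsP; apply: contraLR dh_gt0; rewrite negb_exists => /forallP w0.
  have wr : forall i j, kap i * (kap j)^`() = kap j * (kap i)^`().
    have := (w0 0, w0 1, w0 2); rewrite /cross3 !ord3_add !negbK !subr_eq0.
    move=> [[/eqP e0 /eqP e1] /eqP e2] i j.
    by case: (ord3P i) (ord3P j) => -> [] ->; rewrite // mulrC ?e0 ?e1 ?e2 mulrC.
  have sk := par_poly_const charK cop wr.
  rewrite -leqNgt leqn0 subn_eq0 /h.
  have : (d < size (H * kap L0)%R)%N.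
    by rewrite ltnNge; apply: contraNN PL0 => le_d; rewrite -coef_X nth_default.
  move=> /leq_trans/(_ (size_polyMleq _ _)); have := sk L0.
  by move: (size _) (size _) => a b; lia.
pose bad := H * N * W.
have bad0 : bad != 0 by rewrite !mulf_neq0.
have [rs def_bad] := closed_field_poly_normal bad.
pose kt t k := (kap k).[t].
exists (lform PLx * \prod_(z <- rs) lform (kt z)).
  rewrite mulf_neq0 ?(lform_neq0 PL0) // prodf_seq_neq0.
  by apply/allP=> z _ /=; have [k] := cop z; apply: lform_neq0.
move=> Q; rewrite mevalM mulf_eq0 lform_eval => /norP[QL].
rewrite rmorph_prod /= prodf_seq_neq0 => /allP Qrs.
pose psi := pencil_poly Q.
have psiE t : psi.[t] = dot Q (kt t).
  by rewrite /psi /pencil_poly /dot /= !hornerE.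
have psi_good t : root psi t -> [/\ H.[t] != 0, N.[t] != 0 & W.[t] != 0].
  move=> rt; suff : ~~ root bad t.
    by rewrite !rootM !negb_or => /andP[/andP[]].
  apply/negP; rewrite def_bad rootZ ?lead_coef_eq0 // root_prod_XsubC => /Qrs.
  by rewrite /= lform_eval -psiE (rootP rt) eqxx.
have xkap := center_orth HX H0.
have xkt t : dot x (kt t) = 0.
  have := congr1 (fun q : {poly K} => q.[t]) xkap.
  by rewrite /dot /= !hornerE.
have Qx : ~ par Q x.
  move=> Qx; case/negP: QL; rewrite /dot /PLx /cross3 !ord3_add.
  have := (cross_par Qx 0, cross_par Qx 1, cross_par Qx 2).
  rewrite /cross3 !ord3_add => -[[e0 e1] e2].
  apply/eqP; transitivity ((P 0)`_d * - (Q 1 * x 2 - Q 2 * x 1)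
    + (P 1)`_d * - (Q 2 * x 0 - Q 0 * x 2) + (P 2)`_d * - (Q 0 * x 1 - Q 1 * x 0)).
    by ring.
  by rewrite e0 e1 e2 oppr0 !mulr0 !addr0.
have psi0 : psi != 0 by rewrite -size_poly_eq0 size_pencil_poly.
have psi'P t : root psi t -> psi^`().[t] != 0.
  move=> rt; have [_ _ Wt] := psi_good t rt; apply: contraNneq Wt => psi't.
  pose kt' k := (kap k)^`().[t].
  have orth1 : par (kt t) (cross3 Q x).
    by apply: orth_par; rewrite ?xkt // -psiE; apply/rootP.
  have orth2 : par kt' (cross3 Q x).
    apply: orth_par.
      rewrite -psi't /psi /pencil_poly /dot /= !derivD !deriv_mulC.
      by rewrite !hornerE.
    have := congr1 (fun q : {poly K} => q^`().[t]) xkap.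
    by rewrite /dot /= !derivD !deriv_mulC deriv0 !hornerE.
  have [j wj] := notpar_cross Qx.
  have par12 := par_trans wj orth1 (par_sym orth2).
  have [i ->] := Wdef; have := cross_par par12 i.
  by rewrite /cross3 !hornerE /= => ->.
have [ts [uts sts rts]] := distinct_roots psi0 psi'P.
exists ts; split=> //; first by rewrite sts size_pencil_poly.
move=> t; rewrite rts => rt; have [Ht Nt _] := psi_good t rt.
split=> //; first exact: psi'P.
have HXt k : cross3 (fun i => (P i).[t]) x k = H.[t] * kt t k.
  have := congr1 (fun q : {poly K} => q.[t]) (HX k).
  by rewrite /cross3 /= !hornerE.
apply: plane_decomp => //.
  move=> /cross_par e; have [k] := cop t.
  by have := e k; rewrite HXt => /eqP; rewrite mulf_eq0 (negPf Ht) /= /kt => ->.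
have -> : det3 (fun i => (P i).[t]) Q x = - dot Q (cross3 (fun i => (P i).[t]) x).
  by rewrite /det3 /dot /cross3 !ord3_add; ring.
have -> : dot Q (cross3 (fun i => (P i).[t]) x) = H.[t] * dot Q (kt t).
  by rewrite /dot !HXt; ring.
by rewrite -psiE (rootP rt) mulr0 oppr0.
Qed.

End GenericRoots.
(** * The implicit equation *)

Lemma seq_transport (T U : eqType) (Rel : T -> U -> Prop) (ts : seq T) :
  uniq ts -> {in ts, forall t, exists y, Rel t y} ->
  {in ts &, forall t t' , forall y, Rel t y -> Rel t' y -> t = t'} ->
  exists ys : seq U, [/\ uniq ys, size ys = size ts &
     {in ys, forall y, exists2 t, t \in ts & Rel t y}].
Proof.
elim: ts => [|t ts IH] /=; first by exists [::].
move=> /andP[t_ts uts] ex inj.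
have [||ys [uys sys ysP]] := IH uts.
- by move=> t' ts_t'; apply: ex; rewrite inE ts_t' orbT.
- by move=> t1 t2 h1 h2; apply: inj; rewrite inE ?h1 ?h2 orbT.
have [y Ry] := ex t (mem_head _ _); exists (y :: ys); split=> /=.
- rewrite uys andbT; apply: contra t_ts => /ysP[t' ts_t' Ry'].
  by rewrite (inj t t' _ _ y) ?mem_head // inE ts_t' orbT.
- by rewrite sys.
- move=> z; rewrite inE => /orP[/eqP ->|/ysP[t' ts_t' Rz]].
    by exists t; rewrite ?mem_head.
  by exists t' => //; rewrite inE ts_t' orbT.
Qed.

Lemma mpoly3_ext (K : closedFieldType) (F G : {mpoly K[3]}) :
  (forall v, F.@[v] = G.@[v]) -> F = G.
Proof.
move=> FG; apply/eqP; rewrite -subr_eq0; apply: contraT => /mpoly3_nonzero_eval[v].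
by rewrite mevalB FG subrr eqxx.
Qed.

Lemma mpoly3_dense (K : closedFieldType) (F E : {mpoly K[3]}) : E != 0 ->
  (forall v, E.@[v] != 0 -> F.@[v] = 0) -> F = 0.
Proof.
move=> E0 FE; have /eqP : F * E = 0.
  apply: mpoly3_ext => v; rewrite mevalM meval0.
  by have [->|/FE->] := eqVneq E.@[v] 0; rewrite ?mulr0 ?mul0r.
by rewrite mulf_eq0 (negPf E0) orbF => /eqP.
Qed.

Lemma poly_ext_cofinite (K : closedFieldType) (f g : {poly K}) : g != 0 ->
  (forall t, g.[t] != 0 -> f.[t] = 0) -> f = 0.
Proof.
move=> g0 fg; apply/eqP; apply: contraT => f0.
have /closed_nonrootP[t] : f * g != 0 by rewrite mulf_neq0.
by rewrite rootM negb_or /root => /andP[ft /fg ft0]; rewrite ft0 eqxx in ft.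
Qed.

Lemma horner_char_poly (R : comNzRingType) k (A : 'M[R]_k) y :
  (char_poly A).[y] = \det (y%:M - A).
Proof.
rewrite -/(horner_eval y _) /char_poly -det_map_mx; congr (\det _).
apply/matrixP=> i j; rewrite !mxE /= /horner_eval !hornerE.
by rewrite hornerMn hornerX.
Qed.

Section ImplicitForm.
Variables (K : closedFieldType) (charK : [pchar K] =i pred0).
Variables (n : nat) (P : 'I_3 -> {poly K}).
Let d := n.+1.
Hypothesis sP : forall k, (size (P k) <= d.+1)%N.
Hypothesis topP : exists k, (P k)`_d != 0.
Hypothesis copP : forall t, exists k, (P k).[t] != 0.

Let Pt t k := (P k).[t].
Let PL k := (P k)`_d.

Definition bez_form : {mpoly K[3]} :=
  \det (pencil d (fun k => map_poly (@mpolyC 3 K) (P k)) (fun k => 'X_k)).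

Lemma mmap_bez_form (S : comNzRingType) (phi : {rmorphism K -> S}) (Q : 'I_3 -> S) :
  mmap phi Q bez_form = \det (pencil d (fun k => map_poly phi (P k)) Q).
Proof.
rewrite /bez_form -(det_map_mx (mmap phi Q)) map_pencil; congr (\det _).
apply: eq_pencil => k.
  by rewrite -map_poly_comp; apply: eq_map_poly => c /=; rewrite mmapC.
by rewrite /= mmapX mmap1U.
Qed.

Lemma meval_bez_form Q : bez_form.@[Q] = \det (pencil d P Q).
Proof.
rewrite /meval mmap_bez_form; congr (\det _); apply: eq_pencil => // k.
by rewrite map_poly_id.
Qed.

Lemma bez_form_curve t : bez_form.@[Pt t] = 0.
Proof.
rewrite meval_bez_form; apply/eqP; rewrite -det_tr; apply/det0P.
exists (monomial_col d t)^T.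
  apply/eqP=> /rowP/(_ ord0)/eqP; rewrite !mxE expr0; exact/negP/oner_neq0.
rewrite -trmx_mul pencil_powcol // -[RHS]trmx0; congr (_^T).
by apply/colP=> i; rewrite !mxE det3E /Pt; ring.
Qed.

Variables (F : {mpoly K[3]}) (D : nat).
Hypothesis homF : F \is D.-homog.
Hypothesis irrF : mpoly_irreducible F.
Hypothesis FP : forall t, F.@[Pt t] = 0.

Lemma homog_meval (c : K) (Q : 'I_3 -> K) :
  F.@[fun k => c * Q k] = c ^+ D * F.@[Q].
Proof. exact: mmap_homog. Qed.

Lemma form_par0 u v j : v j != 0 -> par u v -> F.@[v] = 0 -> F.@[u] = 0.
Proof.
move=> vj uv Fv; rewrite (meval_eq (v2 := fun k => (u j / v j) * v k)).
  by rewrite homog_meval Fv mulr0.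
exact: par_scale vj uv.
Qed.

(** The reversed polynomials t^d P_k(1/t) parametrize the same points and take the
    value [PL] at zero. *)
Lemma form_limit : F.@[PL] = 0.
Proof.
pose Pr k := \poly_(i < d.+1) (P k)`_(d - i).
pose q := mmap polyC Pr F.
have qE u : q.[u] = F.@[fun k => (Pr k).[u]].
  rewrite /q -/(horner_eval u _) map_mmap; apply: eq_mmap => // c.
  by rewrite /= /horner_eval hornerC.
have q0 : q = 0.
  apply: (@poly_ext_cofinite _ _ 'X); rewrite ?polyX_eq0 // => u.
  rewrite hornerX => u0; rewrite qE.
  rewrite (meval_eq (v2 := fun k => u ^+ d * Pt u^-1 k)).
    by rewrite homog_meval FP mulr0.
  move=> k; rewrite /Pt (horner_coef_wide _ (sP k)) horner_poly mulr_sumr.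
  rewrite (reindex_inj rev_ord_inj) /=; apply: eq_bigr => i _.
  have le_id : (i <= d)%N by rewrite -ltnS.
  rewrite subSS subKn // mulrCA; congr (_ * _).
  have -> : u ^+ d = u ^+ (d - i) * u ^+ i by rewrite -exprD subnK.
  by rewrite exprVn mulfK ?expf_neq0.
have := qE 0; rewrite q0 horner0 => /esym; congr (_ = _); apply: meval_eq => k.
by rewrite /Pr horner_coef0 coef_poly /= subn0.
Qed.

Variables (Mf Nf : {mpoly K[3]}) (e : nat).
Hypotheses (homM : Mf \is e.-homog) (homN : Nf \is e.-homog).
Hypothesis NP0 : exists t, Nf.@[Pt t] != 0.
Hypothesis MN : forall t, Nf.@[Pt t] != 0 -> Mf.@[Pt t] / Nf.@[Pt t] = t.

Definition den_poly : {poly K} := mmap polyC P Nf.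

Lemma mmap_curve_horner (G : {mpoly K[3]}) t : (mmap polyC P G).[t] = G.@[Pt t].
Proof.
rewrite -/(horner_eval t _) map_mmap; apply: eq_mmap => // c.
by rewrite /= /horner_eval hornerC.
Qed.

Lemma den_poly_neq0 : den_poly != 0.
Proof.
have [t] := NP0; apply: contraNneq => N0.
by rewrite -mmap_curve_horner -/den_poly N0 horner0.
Qed.

Lemma param_inj c t t' : c != 0 -> den_poly.[t] != 0 ->
  (forall k, Pt t k = c * Pt t' k) -> t = t'.
Proof.
move=> c0; rewrite mmap_curve_horner => Nt Ptt'.
have scal (G : {mpoly K[3]}) : G \is e.-homog -> G.@[Pt t] = c ^+ e * G.@[Pt t'].
  by move=> homG; rewrite (meval_eq _ Ptt'); apply: mmap_homog.
have := Nt; rewrite (scal _ homN) mulf_eq0 => /norP[ce0 Nt'].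
rewrite -(MN Nt) -(MN Nt') (scal _ homN) (scal _ homM).
by rewrite -mulf_div divff // mul1r.
Qed.

(** A generic line through [x] meets the curve outside [x] in d - deg H distinct
    points, H being the fibre function of [x]. They come from distinct parameters by
    [generic_roots], and they are distinct because the denominator of the inverse of
    the parametrization does not vanish at them. *)
Lemma generic_line (x : 'I_3 -> K) H kap :
  (forall k, cross3 P (polyC \o x) k = H * kap k) ->
  (forall t, exists k, (kap k).[t] != 0) -> ~ par PL x ->
  exists2 E : {mpoly K[3]}, E != 0 & forall Q, E.@[Q] != 0 ->
    exists ys : seq K, [/\ uniq ys, size ys = (d - (size H).-1)%N &
      {in ys, forall y, exists t, exists2 c, c != 0 &
         forall i, Q i + y * x i = c * Pt t i}].
Proof.
move=> HX cop nlim.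
have [E E0 EQ] := generic_roots charK sP HX cop nlim den_poly_neq0.
exists E => // Q /EQ[ts [uts sts tsP]].
pose Rel t y := exists2 c, c != 0 & forall i, Q i + y * x i = c * Pt t i.
have [||ys [uys sys ysP]] := seq_transport (Rel := Rel) uts.
- move=> t /tsP[_ _ [k [l [k0 PE]]]]; exists (l / k), k^-1; first by rewrite invr_eq0.
  by move=> i; rewrite /Pt PE mulrDr mulKf // mulrA [k^-1 * l]mulrC.
- move=> t t' /tsP[Nt _ _] _ y [c c0 cE] [c' c'0 c'E].
  apply: (param_inj (c := c^-1 * c')) => //; first by rewrite mulf_neq0 ?invr_eq0.
  by move=> i; rewrite -mulrA -c'E cE mulKf.
exists ys; split=> //; first by rewrite sys sts.
by move=> y /ysP[t _ Rty]; exists t.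
Qed.

Lemma irr_neq0 : F != 0.
Proof.
apply/eqP=> F0; have [_ /(_ 0 0)] := irrF; rewrite mulr0 => /(_ F0).
by case; rewrite unitr0.
Qed.

Section Center.
Variable a : 'I_3 -> K.
Hypothesis Fa : F.@[a] != 0.

Let kap k := cross3 P (polyC \o a) k.

Lemma center_off_curve t : ~ par a (Pt t).
Proof.
move=> par_a; have [j Pj] := copP t; case/eqP: Fa.
exact: (@form_par0 a (Pt t) j Pj par_a (FP t)).
Qed.

Lemma center_cop t : exists k, (kap k).[t] != 0.
Proof.
have [k ck] := notpar_cross (fun h => center_off_curve (par_sym h) (t := t)).
by exists k; move: ck; rewrite /kap /cross3 /= !hornerE.
Qed.

Lemma center_notlim : ~ par PL a.
Proof.
move=> /par_sym par_a; have [j Pj] := topP.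
by case/eqP: Fa; exact: (@form_par0 a PL j Pj par_a form_limit).
Qed.

(** Let t_1, ..., t_d be the parameters of the points on a generic line through [a]. In
    the vectors (1, t_i, t_i^2, ...) the matrix becomes diagonal: the
    entry (i, j) is det(a, P(t_i), P(t_j)) / (t_i - t_j), which vanishes because the
    points are collinear with [a], and the diagonal entries do not vanish because
    the t_i are simple roots. *)
Lemma pencil_center_neq0 : \det (pencil d P a) != 0.
Proof.
have HX k : cross3 P (polyC \o a) k = 1 * kap k by rewrite mul1r.
have [E E0 EQ] := generic_roots charK sP HX center_cop center_notlim den_poly_neq0.
have [Q /EQ[ts [uts sts tsP]]] := mpoly3_nonzero_eval E0.
rewrite size_poly1 subn0 in sts.
pose t_ (i : 'I_d) := ts`_i.
have ts_t i : t_ i \in ts by rewrite mem_nth // sts.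
pose V : 'M[K]_d := \matrix_(i, j) t_ i ^+ j.
suff : \det (V *m pencil d P a *m V^T) != 0.
  by rewrite !det_mulmx; apply: contraNneq => ->; rewrite mulr0 mul0r.
have ent i j : (V *m pencil d P a *m V^T) i j =
    ((monomial_col d (t_ i))^T *m pencil d P a *m monomial_col d (t_ j)) 0 0.
  have -> : (monomial_col d (t_ i))^T = row i V by apply/rowP=> k; rewrite !mxE.
  have -> : monomial_col d (t_ j) = col j V^T by apply/colP=> k; rewrite !mxE.
  by rewrite colE mulmxA -row_mul -row_mul -colE [RHS]mxE [RHS]mxE.
have diag : is_diag_mx (V *m pencil d P a *m V^T).
  apply/is_diag_mxP=> i j nij; rewrite ent.
  have ntij : t_ i - t_ j != 0.
    rewrite subr_eq0 nth_uniq ?sts //.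
  apply: (mulIf ntij); rewrite mul0r pencil_off_diag //.
  have [_ _ [k [l [k0 Pi]]]] := tsP _ (ts_t i).
  have [_ _ [k' [l' [k'0 Pj]]]] := tsP _ (ts_t j).
  by rewrite det3E !Pi !Pj; ring.
have /is_diag_mx_is_trig trig := diag; rewrite det_trig //.
apply/prodf_neq0 => i _; rewrite ent pencil_diag //.
have [_ psi' [k [l [k0 Pi]]]] := tsP _ (ts_t i).
have -> : det3 a (fun j => (P j)^`().[t_ i]) (fun j => (P j).[t_ i])
     = - k * (pencil_poly kap Q)^`().[t_ i].
  rewrite det3E !Pi /pencil_poly /kap /dot /cross3 !ord3_add /=.
  rewrite !derivD !deriv_mulC !derivB ![_ * (a _)%:P]mulrC !deriv_mulC !hornerE.
  by ring.
by rewrite mulf_neq0 // oppr_eq0.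
Qed.

(** Restrict both forms to the line Q + X a with generic [Q]. Then [bez_form] becomes a
    constant times a characteristic polynomial, which is monic in X of degree d, and the
    remainder of the division of F by it has d distinct zeros, so it vanishes. *)
Lemma bez_form_dvd : exists U, F = bez_form * U.
Proof.
pose R := {mpoly K[3]}.
have HX k : cross3 P (polyC \o a) k = 1 * kap k by rewrite mul1r.
have [E E0 EQ] := generic_line HX center_cop center_notlim.
pose Ba := pencil d P a.
have UBa : Ba \in unitmx by rewrite unitmxE unitfE pencil_center_neq0.
pose Y (k : 'I_3) : {poly R} := ('X_k)%:P + ((a k)%:MP)%:P * 'X.
pose Fa' : {poly R} := mmap (polyC \o @mpolyC 3 K) Y F.
pose BX := pencil d (fun k => map_poly (@mpolyC 3 K) (P k)) (fun k => 'X_k).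
pose chi : {poly R} := char_poly (- (map_mx (@mpolyC 3 K) (invmx Ba) *m BX)).
have chi_monic : chi \is monic := char_poly_monic _.
have chiQ Q y : (map_poly (meval Q) chi).[y]
    = (\det Ba)^-1 * bez_form.@[fun k => Q k + y * a k].
  rewrite /chi map_char_poly horner_char_poly meval_bez_form pencilD pencilZ.
  have -> : map_mx (meval Q) (- (map_mx (@mpolyC 3 K) (invmx Ba) *m BX))
      = - (invmx Ba *m pencil d P Q).
    rewrite map_mxN map_mxM -map_mx_comp; congr (- (_ *m _)).
      by rewrite (eq_map_mx _ (mevalC Q)) map_mx_id.
    rewrite /BX map_pencil; apply: eq_pencil => k /=; last by rewrite mevalXU.
    by rewrite -map_poly_comp (eq_map_poly (mevalC Q)) map_poly_id.
  rewrite opprK -det_inv -det_mulmx mulmxDr -scalemxAr mulVmx //.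
  by rewrite scalemx1 addrC.
have FaQ Q y : (map_poly (meval Q) Fa').[y] = F.@[fun k => Q k + y * a k].
  rewrite /Fa' (map_mmap _ (map_poly (meval Q))) -/(horner_eval y _) map_mmap.
  apply: eq_mmap => [c|k]; rewrite /= /horner_eval.
    by rewrite map_polyC hornerC /= mevalC.
  rewrite /Y rmorphD rmorphM /= !map_polyC map_polyX /= mevalXU mevalC.
  by rewrite !hornerE mulrC.
pose r := Fa' %% chi; pose q := Fa' %/ chi.
have Fa_eq : Fa' = q * chi + r by apply: Pdiv.IdomainMonic.divp_eq.
have sr : (size r <= d)%N.
  by rewrite -ltnS -(size_char_poly (- (map_mx (@mpolyC 3 K) (invmx Ba) *m BX)))
    ltn_modp monic_neq0.
have r0 : r = 0.
  apply/polyP=> j; rewrite coef0; apply: (mpoly3_dense E0) => Q /EQ[ys [uys sys ysP]].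
  rewrite -coef_map /=.
  suff -> : map_poly (meval Q) r = 0 by rewrite coef0.
  apply: (roots_geq_poly_eq0 _ uys).
    apply/allP=> y /ysP[t [c c0 cE]]; apply/rootP.
    have := congr1 (fun f : {poly R} => (map_poly (meval Q) f).[y]) Fa_eq.
    rewrite /= rmorphD rmorphM /= !hornerE FaQ chiQ.
    rewrite !(meval_eq _ cE) homog_meval FP mulr0.
    have -> : bez_form.@[fun i => c * Pt t i] = 0.
      rewrite meval_bez_form pencilZ detZ -meval_bez_form bez_form_curve.
      by rewrite mulr0.
    by rewrite !mulr0 add0r => /esym.
  by rewrite sys size_poly1 subn0 (leq_trans (size_poly _ _)).
exists (q.[0] * ((\det Ba)^-1)%:MP); apply: mpoly3_ext => v.
have := FaQ v 0; rewrite (meval_eq (v2 := v)); last by move=> k; rewrite mul0r addr0.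
move=> <-; rewrite Fa_eq r0 addr0 rmorphM /= hornerM chiQ.
rewrite [bez_form.@[_]](meval_eq (v2 := v)); last by move=> k; rewrite mul0r addr0.
have -> : (map_poly (meval v) q).[0] = q.[0].@[v].
  by rewrite !horner_coef0 coef_map.
by rewrite !mevalM mevalC; ring.
Qed.

End Center.

(** The determinant of the pencil vanishes on the curve, so it is no unit, and
    it divides the irreducible form F. *)
Theorem implicit_bez_form : exists2 c : K, c != 0 & F = c *: bez_form.
Proof.
have [a Fa] := mpoly3_nonzero_eval irr_neq0.
have [U FU] := bez_form_dvd Fa.
have [_ /(_ _ _ FU)] := irrF; case.
  by move=> /(rmorph_unit (meval (Pt 0))); rewrite /= bez_form_curve unitr0.
move=> /andP[/eqP Uc]; rewrite unitfE => c0; exists U@_0 => //.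
by rewrite FU Uc mulrC mul_mpolyC mcoeffC eqxx mulr1.
Qed.

End ImplicitForm.
(** * Taylor forms and the multiplicity *)

Section TaylorForms.
Variable K : closedFieldType.
Variables (F : {mpoly K[3]}) (D : nat).
Hypotheses (homF : F \is D.-homog) (F0 : F != 0).
Variable x : 'rV[K]_3.

Lemma mmap_taylor (S : comNzRingType) (phi : {rmorphism K -> S}) (Q : 'I_3 -> S) :
  mmap phi Q (taylor F x) = mmap phi (fun k => phi (x 0 k) + Q k) F.
Proof.
rewrite /taylor /comp_mpoly map_mmap; apply: eq_mmap => [c|k] /=.
  by rewrite mmapC.
by rewrite tnth_mktuple mmapD mmapC mmapX mmap1U.
Qed.

Lemma taylor_neq0 : taylor F x != 0.
Proof.
have [v Fv] := mpoly3_nonzero_eval F0; apply: contraNneq Fv => T0.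
have := mmap_taylor (idfun : {rmorphism K -> K}) (fun k => v k - x 0 k).
rewrite T0 -[LHS]/(meval _ 0) meval0 => ->; apply/eqP; apply: eq_mmap => // k.
by rewrite addrC subrK.
Qed.

Lemma mmap_taylor_forms (S : comNzRingType) (phi : {rmorphism K -> S}) (Q : 'I_3 -> S) N :
  (msize (taylor F x) <= N)%N ->
  mmap phi (fun k => phi (x 0 k) + Q k) F = \sum_(k < N) mmap phi Q (taylor_form F x k).
Proof.
move=> sN; rewrite -mmap_taylor {1}(pihomog_partitionE sN).
by rewrite (raddf_sum (mmap phi Q)).
Qed.

Lemma taylor_form_homog k : taylor_form F x k \is k.-homog.
Proof. exact: pihomogP. Qed.

Lemma size_mmap_line (u v : 'I_3 -> K) :
  (size (mmap polyC (fun k => (u k)%:P + 'X * (v k)%:P) F)%R <= D.+1)%N.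
Proof.
rewrite /mmap; apply: (leq_trans (size_sum _ _ _)); apply/bigmax_leqP_seq => m Fm _.
rewrite mul_polyC (leq_trans (size_scale_leq _ _)) //.
have dm : mdeg m = D by have /dhomogP/(_ m Fm) := homF.
rewrite /mmap1 -dm mdegE.
elim/big_ind2: _ => [|p1 n1 p2 n2 h1 h2|i _].
- by rewrite size_poly1.
- rewrite (leq_trans (size_polyMleq _ _)) //.
  by move: h1 h2; move: (size p1) (size p2) => a b; clear; lia.
rewrite (leq_trans (size_poly_exp_leq _ _)) // ltnS.
have : (size ((u i)%:P + 'X * (v i)%:P)%R <= 2)%N.
  rewrite (leq_trans (size_polyD _ _)) // geq_max size_polyC (leq_trans (leq_b1 _)) //=.
  by rewrite mulrC mul_polyC (leq_trans (size_scale_leq _ _)) // size_polyX.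
by case: (size _) => [|[|[|//]]] _ //=; rewrite mul1n.
Qed.

Lemma coef_taylor_line (u : 'I_3 -> K) k :
  (mmap polyC (fun i => (x 0 i)%:P + 'X * (u i)%:P) F)`_k = (taylor_form F x k).@[u].
Proof.
pose N := maxn (msize (taylor F x)) k.+1.
rewrite (mmap_taylor_forms _ _ (N := N)) ?leq_maxl // coef_sum.
have lt_kN : (k < N)%N by rewrite leq_maxr.
rewrite (bigD1 (Ordinal lt_kN)) //= big1 ?addr0 => [|i nik];
  rewrite (mmap_homog _ _ _ (taylor_form_homog _)) coefXnM.
  rewrite ltnn subnn -horner_coef0 -/(horner_eval 0 _) map_mmap.
  by apply: eq_mmap => c /=; rewrite /horner_eval hornerC.
case: ltnP => // le_ik; rewrite -/(meval _ _).
have -> : mmap polyC (fun k0 => (u k0)%:P) (taylor_form F x i)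
   = ((taylor_form F x i).@[u])%:P.
  by rewrite map_mmap.
rewrite coefC subn_eq0 leqNgt ltn_neqAle le_ik andbT.
by move: nik; rewrite -val_eqE /= => ->.
Qed.

Lemma taylor_form_large k : (D < k)%N -> taylor_form F x k = 0.
Proof.
move=> lt_Dk; apply: mpoly3_ext => u; rewrite meval0 -coef_taylor_line.
by rewrite nth_default // (leq_trans (size_mmap_line _ _)).
Qed.

Lemma mmap_taylor_sum (S : comNzRingType) (phi : {rmorphism K -> S}) (Q : 'I_3 -> S) :
  mmap phi (fun k => phi (x 0 k) + Q k) F
    = \sum_(k < D.+1) mmap phi Q (taylor_form F x k).
Proof.
pose N := maxn (msize (taylor F x)) D.+1.
rewrite (mmap_taylor_forms _ _ (N := N)) ?leq_maxl //.
rewrite [RHS](big_ord_widen N (fun k => mmap phi Q (taylor_form F x k))) ?leq_maxr //.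
rewrite [RHS]big_mkcond /=; apply: eq_bigr => k _; case: ltnP => // lt_Dk.
by rewrite taylor_form_large // mmap0.
Qed.

Lemma meval_taylor (mu : K) (u : 'I_3 -> K) : mu != 0 ->
  F.@[fun k => mu * x 0 k + u k]
   = \sum_(k < D.+1) mu ^+ (D - k) * (taylor_form F x k).@[u].
Proof.
move=> mu0.
rewrite (meval_eq (v2 := fun k => mu * (x 0 k + mu^-1 * u k))); last first.
  by move=> k; rewrite mulrDr mulVKf.
rewrite /meval (mmap_homog _ _ _ homF).
rewrite mmap_taylor_sum mulr_sumr.
apply: eq_bigr => i _; rewrite (mmap_homog _ _ _ (taylor_form_homog _)) mulrA.
by congr (_ * _); rewrite -{1}(subnK (ltn_ord i : (i <= D)%N)) exprD exprVn mulfK ?expf_neq0.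
Qed.

Let m := multiplicity F x.

Lemma taylor_form_lt_mult k : (k < m)%N -> taylor_form F x k = 0.
Proof.
move=> lt_km; have := before_find 0%N lt_km => /negbFE/eqP.
rewrite nth_iota ?add0n // (leq_trans lt_km) // -[X in (_ <= X)%N](size_iota 0).
exact: find_size.
Qed.

Lemma taylor_form_mult : taylor_form F x m != 0.
Proof.
have hasF : has (fun k => taylor_form F x k != 0) (iota 0 (msize (taylor F x))).
  apply: contraNT taylor_neq0 => /hasPn h.
  rewrite {1}(pihomog_partitionE (leqnn (msize (taylor F x)))) big1 // => i _.
  by have := h i; rewrite mem_iota ltn_ord /= negbK => /(_ isT)/eqP.
have := nth_find 0%N hasF; rewrite nth_iota ?add0n //.
by rewrite -{2}(size_iota 0 (msize _)) -has_find.
Qed.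

Lemma mult_le_deg : (m <= D)%N.
Proof.
by rewrite leqNgt; apply: contra taylor_form_mult => /taylor_form_large ->.
Qed.

(** The coefficient of X^(D - k) on the line Q + X x is the k-th Taylor form at x
    evaluated at Q, and these vanish below the multiplicity. *)
Lemma size_line_through (Q : 'I_3 -> K) :
  (size (mmap polyC (fun k => (Q k)%:P + 'X * (x 0 k)%:P) F)%R <= (D - m).+1)%N.
Proof.
set f := mmap _ _ _.
suff -> : f = \sum_(k < D.+1) (taylor_form F x k).@[Q] *: 'X^(D - k).
  apply: (leq_trans (size_sum _ _ _)); apply/bigmax_leqP => i _.
  have [/taylor_form_lt_mult->|le_mi] := ltnP i m.
    by rewrite meval0 scale0r size_poly0.
  by rewrite (leq_trans (size_scale_leq _ _)) // size_polyXn ltnS leq_sub2l.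
apply/eqP; rewrite -subr_eq0; apply/eqP.
apply: (@poly_ext_cofinite _ _ 'X); rewrite ?polyX_eq0 // => y; rewrite hornerX => y0.
rewrite hornerD hornerN -/(horner_eval y _) /f map_mmap.
have -> : mmap (horner_eval y \o polyC)
   (horner_eval y \o (fun k => (Q k)%:P + 'X * (x 0 k)%:P)) F
   = F.@[fun k => y * x 0 k + Q k].
  apply: eq_mmap => [c|k]; rewrite /= /horner_eval !hornerE //.
  by rewrite addrC.
rewrite meval_taylor // horner_sum -sumrB big1 // => i _.
by rewrite !hornerE mulrC subrr.
Qed.

(** The tangent cone at [x] is a union of lines through [x]: as F is homogeneous, the points
    x + y (w + c x) = (1 + c y) x + y w allow two expansions in y, whose terms of order
    m are the two sides. *)
Lemma taylor_form_invariant c (w : 'I_3 -> K) :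
  (taylor_form F x m).@[fun k => w k + c * x 0 k] = (taylor_form F x m).@[w].
Proof.
rewrite -coef_taylor_line.
set f := mmap _ _ _.
suff -> : f = \sum_(k < D.+1) (taylor_form F x k).@[w] *: ((1 + c *: 'X) ^+ (D - k) * 'X^k).
  have lt_mD : (m < D.+1)%N by rewrite ltnS mult_le_deg.
  rewrite coef_sum (bigD1 (Ordinal lt_mD)) //= big1 ?addr0 => [|i nim].
    rewrite coefZ coefMXn ltnn subnn -horner_coef0 horner_exp.
    by rewrite !hornerE expr1n mulr1.
  rewrite coefZ coefMXn; have [lt_im|le_mi] := ltnP i m.
    by rewrite taylor_form_lt_mult // meval0 mul0r.
  rewrite leq_eqVlt in le_mi; case/orP: le_mi nim => [/eqP e|-> _].
    by rewrite -val_eqE /= e eqxx.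
  by rewrite mulr0.
apply/eqP; rewrite -subr_eq0; apply/eqP.
apply: (@poly_ext_cofinite _ _ (1 + c *: 'X)) => [|y].
  apply/eqP=> /(congr1 (fun q : {poly K} => q.[0])); rewrite !hornerE => /eqP.
  by rewrite oner_eq0.
rewrite !hornerE => y0; rewrite -/(horner_eval y _) /f map_mmap.
have -> : mmap (horner_eval y \o polyC)
   (horner_eval y \o (fun k => (x 0 k)%:P + 'X * (w k + c * x 0 k)%:P)) F
   = F.@[fun k => (1 + c * y) * x 0 k + y * w k].
  apply: eq_mmap => [a|k]; rewrite /= /horner_eval !hornerE //.
  by ring.
rewrite meval_taylor // horner_sum -sumrB big1 // => i _.
rewrite /meval (mmap_homog _ _ _ (taylor_form_homog _)).
by rewrite !hornerE [X in X - _]mulrC mulrA subrr.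
Qed.

End TaylorForms.
(** * The fibre function divides the minor *)

Lemma card_ord_geq k r : (r <= k)%N -> #|[pred i : 'I_k | ~~ (i < r)%N]| = (k - r)%N.
Proof.
move=> le_rk; have := cardC [pred i : 'I_k | (i < r)%N].
rewrite card_ord -[X in (X + _)%N]sum1_card -(big_ord_widen k (fun=> 1%N)) //.
by rewrite sum1_card card_ord => e; rewrite -[in RHS]e addKn.
Qed.

(** After Gaussian elimination of the constant matrix [C *m B] all rows but its rank
    many are divisible by [H]. *)
Lemma det_low_rank (K : fieldType) k r (C : 'M[K]_(k, r)) (B : 'M[K]_(r, k))
    (lam H : {poly K}) (N : 'M[{poly K}]_k) :
  H ^+ (k - r) %| \det (lam *: map_mx polyC (C *m B) + H *: N).
Proof.
set A := C *m B.
have rkA : (\rank A <= r)%N.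
  by rewrite (leq_trans (mxrankM_maxl _ _)) // rank_leq_col.
apply: (dvdp_trans (dvdp_exp2l H (leq_sub2l k rkA))).
pose L := map_mx polyC (col_ebase A); pose R := map_mx polyC (row_ebase A).
have UL : L \in unitmx by rewrite map_unitmx // col_ebase_unit.
have UR : R \in unitmx by rewrite map_unitmx // row_ebase_unit.
pose N' := invmx L *m N *m invmx R.
have -> : lam *: map_mx polyC A + H *: N
    = L *m (lam *: pid_mx (\rank A) + H *: N') *m R.
  rewrite mulmxDr mulmxDl -!scalemxAr -!scalemxAl; congr (_ *: _ + _ *: _).
    by rewrite -{1}(mulmx_ebase A) !map_mxM map_pid_mx.
  by rewrite /N' !mulmxA mulmxV // mul1mx mulmxKV.
rewrite !det_mulmx mulrAC dvdp_mull //.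
pose dg : 'rV[{poly K}]_k := \row_i (if (i < \rank A)%N then 1 else H).
pose N'' : 'M[{poly K}]_k := \matrix_(i, j)
   (if (i < \rank A)%N then lam * (i == j)%:R + H * N' i j else N' i j).
have -> : lam *: pid_mx (\rank A) + H *: N' = diag_mx dg *m N''.
  rewrite mul_diag_mx; apply/matrixP=> i j; rewrite !mxE.
  by case: ltnP => _; rewrite ?andbT ?andbF ?mul1r ?mulr0 ?add0r.
rewrite det_mulmx det_diag dvdp_mulr //.
rewrite (bigID (fun i : 'I_k => (i < \rank A)%N)) /= dvdp_mull //.
rewrite (eq_bigr (fun=> H)); last by move=> i /negPf ge_i; rewrite mxE ge_i.
rewrite prodr_const.
by rewrite card_ord_geq ?dvdpp // rank_leq_row.
Qed.

Lemma ord3_split (j k : 'I_3) : [\/ k = j, k = j + 1 | k = j + 2].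
Proof.
by case: (ord3P j) (ord3P k) => -> [] ->; rewrite !ord3_add;
  do ?[by apply: Or31 | by apply: Or32 | by apply: Or33].
Qed.

Lemma ord3_addA (j : 'I_3) : (((j + 1 + 1)%R = (j + 2)%R) * ((j + 1 + 2)%R = j)
   * ((j + 2 + 1)%R = j) * ((j + 2 + 2)%R = (j + 1)%R))%type.
Proof. by case: (ord3P j) => ->; rewrite !ord3_add. Qed.

Section Center.
Variables (K : closedFieldType) (d : nat) (P : 'I_3 -> {poly K}) (x : 'I_3 -> K).
Hypothesis sP : forall k, (size (P k) <= d.+1)%N.
Variables (H : {poly K}) (kap : 'I_3 -> {poly K}).
Hypothesis HX : forall k, cross3 P (polyC \o x) k = H * kap k.
Hypothesis cop : forall t, exists k, (kap k).[t] != 0.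
Hypothesis H0 : H != 0.

Let h := (size H).-1.

(** The rows of the pencil at [x] are det(x, P^(i), P), that is, the dot product of the
    vector P^(i) of Horner quotients with [cross3 P x], which is H kap. So they lie in
    the space of multiples of [H] of degree less than [d], of dimension d - h. *)
Lemma pencil_center_factor :
  exists (C : 'M[K]_(d, d - h)) (B : 'M[K]_(d - h, d)), pencil d P x = C *m B.
Proof.
pose c (i : 'I_d) := dot (fun k => drop_poly i.+1 (P k)) kap.
have rowE (i : 'I_d) : \sum_k (x k)%:P * bez_row (P (k + 1)) (P (k + 2)) i = H * c i.
  have -> : H * c i = dot (fun k => drop_poly i.+1 (P k)) (cross3 P (polyC \o x)).
    by rewrite /dot !HX /c /dot; ring.
  by rewrite sum3 /bez_row /dot /cross3 !ord3_add /=; ring.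
have sc i : (size (c i) <= d - h)%N.
  have [->|ci0] := eqVneq (c i) 0; first by rewrite size_poly0.
  have : (size (H * c i)%R <= d)%N.
    rewrite -rowE (leq_trans (size_sum _ _ _)) //; apply/bigmax_leqP => k _.
    by rewrite mul_polyC (leq_trans (size_scale_leq _ _)) // size_bez_row.
  rewrite size_mul // /h.
  have : (0 < size H)%N by rewrite size_poly_gt0.
  by set s1 := size H; set s2 := size (c i); clearbody s1 s2; clear; lia.
exists (\matrix_i poly_rV (c i)), (lin1_mx (poly_rV \o H \o* rVpoly)).
apply/row_matrixP=> i; rewrite row_mul rowK mul_rV_lin1 /= poly_rV_K //.
rewrite mulrC -rowE; apply/rowP=> j; rewrite !mxE sum3 !coefD !coefCM /dot.
by [].
Qed.

(** Modulo the fibre function the curve stays at the point [x]. The remainder [z]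
    has no component along the coordinate where x_j is not zero, so it
    is never parallel to [x]. *)
Lemma center_decomp j : x j != 0 -> exists (lam : {poly K}) (z : 'I_3 -> {poly K}),
  [/\ forall k, P k = lam * (x k)%:P + H * z k, z j = 0 &
      forall t, exists k, (z k).[t] != 0].
Proof.
move=> xj0.
pose lam := (x j)^-1 *: P j.
have xkap := center_orth HX H0.
pose z k := if k == j then 0 else
  (x j)^-1 *: (if k == j + 1 then - kap (j + 2) else kap (j + 1)).
have nj : (((j + 1)%R == j = false) * ((j + 2)%R == j = false)
    * ((j + 2)%R == (j + 1)%R = false))%type.
  by case: (ord3P j) => ->; rewrite !ord3_add.
have xP k : (x j)%:P * (P k) = (x k)%:P * P j + (x j)%:P * (H * z k).
  have vx (q : {poly K}) : (x j)%:P * ((x j)^-1 *: q) = q.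
    by rewrite mul_polyC scalerA mulfV // scale1r.
  have := (HX (j + 1), HX (j + 2)); rewrite /cross3 !ord3_addA /= => -[e1 e2].
  case: (ord3_split j k) => ->; rewrite /z ?eqxx ?nj.
  - by rewrite !mulr0 addr0.
  - by rewrite mulrCA vx mulrN -e2; ring.
  - by rewrite mulrCA vx -e1; ring.
exists lam, z; split; rewrite ?/z ?eqxx //.
  move=> k; apply: (mulfI (x := (x j)%:P)); first by rewrite polyC_eq0.
  rewrite xP mulrDr -/(z k) /lam; congr (_ + _).
  by rewrite mulrA [_%:P * (_ *: _)]mul_polyC scalerA mulfV // scale1r mulrC.
move=> t; apply/existsP; apply: contraT; rewrite negb_exists => /forallP z0.
have kapt1 : (kap (j + 1)).[t] = 0.
  have := z0 (j + 2); rewrite !nj hornerZ negbK mulf_eq0 invr_eq0 (negPf xj0).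
  by move=> /eqP.
have kapt2 : (kap (j + 2)).[t] = 0.
  have := z0 (j + 1); rewrite !nj eqxx hornerZ negbK mulf_eq0 invr_eq0 (negPf xj0).
  by rewrite hornerN oppr_eq0 => /eqP.
have kaptj : (kap j).[t] = 0.
  have /eqP : x j * (kap j).[t] = 0.
    have := congr1 (fun q : {poly K} => q.[t]) xkap; rewrite /dot /= !hornerE.
    move: kapt1 kapt2; case: (ord3P j) => ->; rewrite !ord3_add => -> ->;
    by rewrite !mulr0 ?addr0 ?add0r.
  by rewrite mulf_eq0 (negPf xj0) => /eqP.
have [k] := cop t.
by case: (ord3_split j k) => ->; rewrite ?kapt1 ?kapt2 ?kaptj eqxx.
Qed.

End Center.

(** Modulo [H] the curve pencil is a polynomial multiple of the constant pencil at [x],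
    whose rank is at most d - deg H. *)
Lemma fibre_corank_dvd_minor (K : closedFieldType) n (P : 'I_3 -> {poly K}) (x : 'I_3 -> K)
    (H : {poly K}) kap j :
  (forall k, (size (P k) <= n.+2)%N) ->
  (forall k, cross3 P (polyC \o x) k = H * kap k) ->
  (forall t, exists k, (kap k).[t] != 0) -> H != 0 -> x j != 0 ->
  H ^+ (n - (n.+1 - (size H).-1)) %| pencil_minor n P.
Proof.
move=> sP HX cop H0 xj0.
have [lam [z [PE _ _]]] := center_decomp HX cop H0 xj0.
have [C [B CB]] := pencil_center_factor sP HX H0.
have -> : pencil_minor n P = \det (lam *: map_mx polyC (row' ord0 C *m col' ord0 B)
    + H *: row' ord0 (col' ord0 (pencil n.+1 (lift_curve P) z))).
  rewrite /pencil_minor; congr (\det _).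
  have -> : curve_pencil n P = lam *: map_mx polyC (pencil n.+1 P x)
                              + H *: pencil n.+1 (lift_curve P) z.
    by rewrite map_pencil -!pencilZ -pencilD; apply: eq_pencil.
  rewrite CB; apply/matrixP=> i l; rewrite !mxE; congr (_ * _%:P + _).
  by apply: eq_bigr => r _; rewrite !mxE.
exact: det_low_rank.
Qed.
(** * The order of the minor along the curve *)

Section LocalOrder.
Variables (K : closedFieldType) (n : nat) (P : 'I_3 -> {poly K}).
Hypothesis sP : forall k, (size (P k) <= n.+2)%N.
Variables (F : {mpoly K[3]}) (D : nat) (c : K).
Hypotheses (homF : F \is D.-homog) (F0 : F != 0).
Hypothesis F_bez : F = c *: bez_form n P.
Hypothesis FP : forall t, F.@[fun k => (P k).[t]] = 0.
Hypothesis copP : forall t, exists k, (P k).[t] != 0.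

(** The value F(P + X b), with X the outer variable: its coefficient of X is the
    derivative of F along the curve in the direction [b]. *)
Definition nearby_form (b : 'I_3 -> {poly K}) : {poly {poly K}} :=
  mmap (polyC \o polyC) (fun k => (P k)%:P + 'X * (b k)%:P) F.

Lemma nearby_form1 b :
  (nearby_form b)`_1 = c%:P * (det3 b (fun k => (P k)^`()) P * pencil_minor n P).
Proof.
rewrite /nearby_form F_bez mmapZ mmap_bez_form /= coefCM; congr (_ * _).
rewrite -(pencil_gradient sP).
set M1 := pencil _ _ _; set M2 := pencil _ _ _.
suff -> : M1 = M2 by []; apply: eq_pencil => k.
  by rewrite /lift_curve -map_poly_comp.
by [].
Qed.

Lemma nearby_form0 b : (nearby_form b)`_0 = 0.
Proof.
apply: (@poly_ext_cofinite _ _ 1) => [|t _]; rewrite ?oner_eq0 //.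
rewrite -horner_coef0 -/(horner_eval 0 _) map_mmap -/(horner_eval t _) map_mmap.
rewrite -[RHS](FP t); apply: eq_mmap => [a|k] /=; rewrite /horner_eval !hornerE //.
Qed.

Lemma map_nearby_form b s0 :
  map_poly (horner_eval s0) (nearby_form b)
    = mmap polyC (fun k => ((P k).[s0])%:P + 'X * ((b k).[s0])%:P) F.
Proof.
rewrite (map_mmap _ (map_poly (horner_eval s0))).
apply: eq_mmap => [a|k] /=; first by rewrite !map_polyC /= /horner_eval hornerC.
by rewrite rmorphD rmorphM /= !map_polyC map_polyX.
Qed.

Lemma minor_neq0_regular (x : 'rV[K]_3) s0 : (forall k, x 0 k = (P k).[s0]) ->
  taylor_form F x 1 != 0 -> (pencil_minor n P).[s0] != 0.
Proof.
move=> xE /mpoly3_nonzero_eval[u]; apply: contraNneq => minor0.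
rewrite -coef_taylor_line.
have -> : mmap polyC (fun i => (x 0 i)%:P + 'X * (u i)%:P) F
   = map_poly (horner_eval s0) (nearby_form (fun k => (u k)%:P)).
  by rewrite map_nearby_form; apply: eq_mmap => // k; rewrite xE hornerC.
by rewrite coef_map /= nearby_form1 /horner_eval !hornerM minor0 !mulr0.
Qed.

Section Ordinary.
Variables (x : 'rV[K]_3) (j0 : 'I_3) (H : {poly K}) (kap : 'I_3 -> {poly K}).
Hypothesis xj0 : x 0 j0 != 0.
Hypothesis HX : forall k, cross3 P (polyC \o x 0) k = H * kap k.
Hypothesis cop : forall t, exists k, (kap k).[t] != 0.
Hypothesis H0 : H != 0.
Let m := multiplicity F x.
Hypothesis m_gt0 : (0 < m)%N.
Variable cc : 'I_m -> 'I_3 -> K.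
Hypothesis cc0 : forall i, exists k, cc i k != 0.
Hypothesis ccx : forall i, dot (x 0) (cc i) = 0.
Hypothesis ccn : forall i j, i != j -> ~ par (cc i) (cc j).
Hypothesis Fm : taylor_form F x m = \prod_i lform (cc i).

Lemma mmap_lform (S : comNzRingType) (phi : {rmorphism K -> S}) (a : 'I_3 -> K) Q :
  mmap phi Q (lform a) = dot (phi \o a) Q.
Proof.
rewrite /lform (raddf_sum (mmap phi Q)) sum3 /dot /=.
by rewrite !mmapZ !mmapX !mmap1U.
Qed.

Variable s0 : K.
Hypothesis Hs0 : root H s0.
Let e := mup s0 H.
Let pi0 := ('X - s0%:P) ^+ e.

(** Modulo a power of X - s0 the factor lam of P = lam x + H z is invertible;
    multiplying the homogeneous coordinates by an inverse [th] normalizes the constant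
    part of the branch to [x] itself. The tangent of the branch then joins [x] and y(s0). *)
Lemma branch_normal_form : exists (th : {poly K}) (y : 'I_3 -> {poly K}),
  [/\ th.[s0] != 0, forall k, th * P k = (x 0 k)%:P + pi0 * y k &
      ~ par (x 0) (fun k => (y k).[s0])].
Proof.
have e_gt0 : (0 < e)%N by rewrite -XsubC_dvd // dvdp_XsubCl.
have [lam [z [PE zj0 copz]]] := center_decomp HX cop H0 xj0.
have [h' def_H h's0] : exists2 h', H = pi0 * h' & h'.[s0] != 0.
  have /dvdpP[h' def_H] : pi0 %| H by rewrite -mup_geq.
  exists h'; first by rewrite mulrC.
  apply/negP=> rh'; have : (e < e)%N; last by rewrite ltnn.
  rewrite {2}/e mup_geq // def_H exprS dvdp_mul // dvdp_XsubCl //.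
have pis0 : pi0.[s0] = 0 by rewrite horner_exp hornerXsubC subrr expr0n gtn_eqF.
have lam_s0 : lam.[s0] != 0.
  have [k] := copP s0; apply: contraNneq => ls.
  by rewrite PE !hornerE ls (rootP Hs0) !mul0r addr0.
have : coprimep lam pi0.
  by rewrite coprimep_expr // coprimep_XsubC.
case/Bezout_eq1_coprimepP => -[th nu] /= bez.
have th_s0 : th.[s0] != 0.
  have := congr1 (fun q : {poly K} => q.[s0]) bez; rewrite /= hornerD !hornerM pis0 mulr0 addr0 hornerC.
  by move=> h1; apply/eqP=> h2; move/eqP: h1; rewrite h2 mul0r eq_sym oner_eq0.
exists th, (fun k => th * h' * z k - nu * (x 0 k)%:P); split=> //.
  move=> k; rewrite PE def_H.
  transitivity ((th * lam + nu * pi0) * (x 0 k)%:P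
     + pi0 * (th * h' * z k - nu * (x 0 k)%:P)); first by ring.
  by rewrite bez mul1r.
move=> pxy; have [k] := copz s0; apply/negP; rewrite negbK.
have := pxy j0 k; rewrite !hornerE zj0 !hornerE.
move=> eq1; have : x 0 j0 * (th.[s0] * h'.[s0] * (z k).[s0]) = 0.
  transitivity (x 0 j0 * (th.[s0] * h'.[s0] * (z k).[s0] - nu.[s0] * x 0 k)
    - x 0 k * (- (nu.[s0] * x 0 j0))); first by ring.
  rewrite eq1; ring.
by move/eqP; rewrite !mulf_eq0 (negPf xj0) (negPf th_s0) (negPf h's0).
Qed.

(** With P in normal form, th (P + pi0 X b) = x + pi0 (y + X th b), so F takes there the
    value pi0^m W, and at s0 the factor W reduces to the product of the tangents at
    y(s0) + X th(s0) b. The constant coefficient in X shows that some tangent vanishes at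
    y(s0), and the others do not, since the tangents are distinct and all pass through
    [x]. If [b] is not on that tangent, the coefficient of X in W is not zero at s0. By
    [nearby_form1] this coefficient times pi0^(m - 1) is a multiple of the minor. *)
Lemma minor_order_le_ordinary : ~~ (('X - s0%:P) ^+ (e * (m - 1)).+1 %| pencil_minor n P).
Proof.
have e_gt0 : (0 < e)%N by rewrite -XsubC_dvd // dvdp_XsubCl.
have pis0 : pi0.[s0] = 0 by rewrite horner_exp hornerXsubC subrr expr0n gtn_eqF.
have pi00 : pi0 != 0 by rewrite expf_neq0 // polyXsubC_eq0.
have [th [y [th_s0 thP nxy]]] := branch_normal_form.
pose y0 k := (y k).[s0].
have key (b : 'I_3 -> K) : exists W : {poly {poly K}},
   ((th ^+ D)%:P * nearby_form (fun k => pi0 * (b k)%:P) = (pi0 ^+ m)%:P * W) /\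
   map_poly (horner_eval s0) W
     = \prod_i dot (polyC \o cc i) (fun k => (y0 k)%:P + 'X * (th.[s0] * b k)%:P).
  pose Y k : {poly {poly K}} := (y k)%:P + 'X * (th * (b k)%:P)%:P.
  exists (\sum_(k < D.+1 | (m <= k)%N)
     (pi0 ^+ (k - m))%:P * mmap (polyC \o polyC) Y (taylor_form F x k)).
  split.
    rewrite rmorphXn /= -(mmap_homog _ _ _ homF).
    transitivity (mmap (polyC \o polyC)
      (fun k => (polyC \o polyC) (x 0 k) + pi0%:P * Y k) F).
      apply: eq_mmap => // k; rewrite /Y /= mulrDr mulrDr -polyCM thP polyCD -addrA.
      congr (_ + _); rewrite polyCM; congr (_ + _).
      by rewrite mulrCA [in RHS]mulrCA -!polyCM; congr (_ * _%:P); ring.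
    rewrite (mmap_taylor_sum homF) (bigID (fun k : 'I_D.+1 => (m <= k)%N)) /=.
    rewrite [X in _ + X]big1 ?addr0 => [|k]; last first.
      by rewrite -ltnNge => /(taylor_form_lt_mult)->; rewrite mmap0.
    rewrite mulr_sumr; apply: eq_bigr => k le_mk.
    rewrite (mmap_homog _ _ _ (taylor_form_homog _ _ _)) mulrA -polyCM -exprD subnKC //.
    by rewrite polyC_exp.
  rewrite rmorph_sum /=.
  have lt_mD : (m < D.+1)%N by rewrite ltnS (mult_le_deg homF F0).
  rewrite (bigD1 (Ordinal lt_mD)) //= big1 ?addr0 => [|k /andP[le_mk nkm]]; last first.
    rewrite rmorphM /= map_polyC /= /horner_eval horner_exp pis0 expr0n.
    case: eqP => [|_]; last by rewrite polyC0 mul0r.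
    move/eqP; rewrite subn_eq0 => le_km; case/negP: nkm.
    by rewrite -val_eqE /= eqn_leq le_km.
  rewrite rmorphM /= map_polyC /= subnn expr0 /horner_eval hornerC mul1r.
  rewrite (map_mmap _ (map_poly (horner_eval s0))) Fm rmorph_prod.
  apply: eq_bigr => i _ /=.
  transitivity (mmap polyC (fun k => (y0 k)%:P + 'X * (th.[s0] * b k)%:P) (lform (cc i))).
    apply: eq_mmap => [a|k] /=; first by rewrite !map_polyC /= /horner_eval hornerC.
    rewrite /Y rmorphD rmorphM /= !map_polyC map_polyX /= /horner_eval.
    by rewrite hornerM hornerC.
  by rewrite mmap_lform.
have [j cj] : exists j, dot (cc j) y0 = 0.
  have [W [eqW WE]] := key (fun=> 0).
  have W0 : W`_0 = 0.
    have := congr1 (fun q : {poly {poly K}} => q`_0) eqW.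
    rewrite /= !coefCM nearby_form0 mulr0 => /esym/eqP.
    by rewrite mulf_eq0 expf_eq0 (negPf pi00) andbF => /eqP.
  have := congr1 (fun q : {poly K} => q`_0) WE.
  rewrite coef_map /= W0 /horner_eval horner0 -horner_coef0 horner_prod.
  move/esym/eqP/prodf_eq0 => [j _ /eqP cj]; exists j; rewrite -[RHS]cj /dot /=.
  by rewrite !hornerE.
have uniq_j i : i != j -> dot (cc i) y0 != 0.
  move=> nij; apply/eqP=> ci; apply: (ccn nij).
  have [k xyk] := notpar_cross nxy.
  have par_c l : dot (cc l) y0 = 0 -> par (cc l) (cross3 (x 0) y0).
    move=> cl; apply: orth_par; first exact: ccx.
    by rewrite -cl /dot; ring.
  exact: (@par_trans _ _ (cross3 (x 0) y0) _ k xyk (par_c _ ci) (par_sym (par_c _ cj))).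
have [k0 cjk0] := cc0 j.
have [W [eqW WE]] := key (fun k => (k == k0)%:R).
have W1 : (W`_1).[s0] != 0.
  have -> : (W`_1).[s0] = (map_poly (horner_eval s0) W)`_1 by rewrite coef_map.
  rewrite WE (bigD1 j) //=.
  set q := \prod_(i < m | _) _.
  have -> : dot (polyC \o cc j) (fun k => (y0 k)%:P + 'X * (th.[s0] * (k == k0)%:R)%:P)
     = 'X * (th.[s0] * cc j k0)%:P.
    transitivity ((dot (cc j) y0)%:P + 'X * (th.[s0] * cc j k0)%:P); last first.
      by rewrite cj polyC0 add0r.
    by case: (ord3P k0) => ->; rewrite /dot /= !(polyCD, polyCM) ?polyC0 ?polyC1; ring.
  rewrite -mulrA coefXM /= coefCM mulf_neq0 ?mulf_neq0 //.
  rewrite -horner_coef0 horner_prod; apply/prodf_neq0 => i nij.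
  by have := uniq_j i nij; rewrite /dot /= !hornerE.
apply: contra W1 => dv; rewrite -/(root _ _) -dvdp_XsubCl.
have eq1 : th ^+ D * (c%:P * (det3 (fun k => pi0 * ((k == k0)%:R)%:P)
     (fun k => (P k)^`()) P * pencil_minor n P)) = pi0 ^+ m * W`_1.
  have := congr1 (fun q : {poly {poly K}} => q`_1) eqW.
  by rewrite /= !coefCM nearby_form1.
have detE : det3 (fun k => pi0 * ((k == k0)%:R)%:P) (fun k => (P k)^`()) P
   = pi0 * det3 (fun k => ((k == k0)%:R)%:P) (fun k => (P k)^`()) P.
  by rewrite !det3E; ring.
have : pi0 ^+ m * ('X - s0%:P) %| pi0 ^+ m * W`_1.
  rewrite -eq1 detE.
  have -> : pi0 ^+ m * ('X - s0%:P) = pi0 * ('X - s0%:P) ^+ (e * (m - 1)).+1.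
    rewrite exprSr mulrA; congr (_ * _).
    by rewrite /pi0 -exprM -exprD; congr (_ ^+ _); move: m_gt0; case: (m) => // k _;
      rewrite subn1 mulnS.
  do 2!rewrite dvdp_mull //; rewrite -mulrA dvdp_mul2l // dvdp_mull //.
by rewrite dvdp_mul2l // expf_neq0.
Qed.

End Ordinary.
End LocalOrder.
(** * Tangents of an ordinary point *)

Section LinearFactors.
Variable K : closedFieldType.
Implicit Types (T : {mpoly K[3]}) (m : nat).

Lemma msize_prod (I : Type) (r : seq I) (L : I -> {mpoly K[3]}) :
  (forall i, L i != 0) ->
  msize (\prod_(i <- r) L i) = (\sum_(i <- r) (msize (L i)).-1).+1.
Proof.
move=> L0; elim: r => [|i r IH]; first by rewrite !big_nil msize1.
rewrite !big_cons msizeM // ?IH; last first.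
  by rewrite -msize_poly_eq0 IH.
by rewrite (mpolySpred _ (L0 i)) addnS.
Qed.

Lemma msize2_affine (L : {mpoly K[3]}) : (msize L <= 2)%N ->
  L = lform (fun k => L@_U_(k)) + (L@_0)%:MP.
Proof.
move=> sL; apply/mpolyP=> mm.
rewrite mcoeffD mcoeffC /lform raddf_sum /= sum3 !mcoeffZ !mcoeffX.
have [/eqP d0|d0] := boolP (mdeg mm == 0%N).
  move/eqP: d0; rewrite mdeg_eq0 => /eqP ->.
  by rewrite eqxx !mnm1_eq0 !mulr0 !add0r mulr1.
have m0 : (mm == 0%MM) = false by rewrite -mdeg_eq0; exact/negbTE.
rewrite m0 mulr0 addr0.
have [/mdeg1P[k /eqP ->]|d1] := boolP (mdeg mm == 1%N).
  by rewrite !eq_mnm1; case: (ord3P k) => ->; rewrite /= !mulr0 mulr1 ?addr0 ?add0r.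
have ne k : (U_(k)%MM == mm) = false.
  by apply: contraNF d1 => /eqP<-; rewrite mdeg1.
rewrite !ne !mulr0 !addr0; apply/eqP; apply: contraT.
rewrite -mcoeff_msupp => /msize_mdeg_lt; move: sL d0 d1.
by move: (mdeg mm) (msize L) => a b; clear; lia.
Qed.

(** The factors are m in number and not constant, so by degree they are affine. If the
    constant term of a factor were not zero, that factor would vanish somewhere outside
    the origin on almost every line through the origin. The form [T] would then vanish on
    all these lines, hence everywhere. *)
Lemma linear_factors m T (L : 'I_m -> {mpoly K[3]}) :
  T \is m.-homog -> T != 0 -> T = \prod_i L i ->
  (forall i, mpoly_irreducible (L i)) ->
  exists cc : 'I_m -> 'I_3 -> K, forall i, L i = lform (cc i).
Proof.
move=> homT T0 TL irrL.
have L0 i : L i != 0.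
  by have := T0; rewrite TL => /prodf_neq0; apply.
have sL_ge i : (1 <= (msize (L i)).-1)%N.
  rewrite leqNgt; apply/negP; rewrite ltnS leqn0 => /eqP s0.
  have s1 : (msize (L i) <= 1)%N by rewrite -(prednK (n := msize _)) ?s0 // lt0n msize_poly_eq0.
  have [nu _] := irrL i; case/negP: nu.
  have Lc := msize1_polyC s1; apply/andP; split; first exact/eqP.
  rewrite unitfE; apply: contraNneq (L0 i) => c0; by rewrite Lc c0 mpolyC0.
have sumL : (\sum_(i < m) (msize (L i)).-1 = m)%N.
  have sT : msize T = m.+1.
    rewrite (mpolySpred _ T0); congr _.+1.
    by apply: (dhomog_uniq T0 _ homT); apply: dhomog_msize homT.
  by have := msize_prod (index_enum 'I_m) L0; rewrite -TL sT => -[].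
have sL i : (msize (L i) <= 2)%N.
  have : ((msize (L i)).-1 <= 1)%N.
    rewrite leqNgt; apply/negP=> gt1; have := sumL; rewrite (bigD1 i) //=.
    have : (\sum_(j < m | j != i) 1 <= \sum_(j < m | j != i) (msize (L j)).-1)%N.
      by apply: leq_sum.
    have : (\sum_(j < m) 1 = m)%N by rewrite sum1_card card_ord.
    rewrite (bigD1 i) //= => e1 le2 e2; have := leq_add gt1 le2.
    by rewrite e2 -[X in (_ <= X)%N]e1 leq_add2r.
  by case: (msize (L i)) => [|[|[|]]].
pose cc i k := (L i)@_U_(k); exists cc => i.
suff c0 : (L i)@_0 = 0 by rewrite {1}(msize2_affine (sL i)) c0 mpolyC0 addr0.
apply/eqP; apply: contraT => c0.
have a0 : lform (cc i) != 0.
  apply: contraTneq (sL_ge i) => a0; rewrite (msize2_affine (sL i)) -/(cc i) a0 add0r.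
  by rewrite msizeC; case: eqP.
suff TE : T = 0 by rewrite TE eqxx in T0.
apply: (mpoly3_dense a0) => w aw.
pose r := - (L i)@_0 / (lform (cc i)).@[w].
have r0 : r != 0 by rewrite mulf_neq0 ?oppr_eq0 ?invr_eq0.
have : T.@[fun k => r * w k] = 0.
  rewrite TL rmorph_prod; apply/eqP; apply/prodf_eq0; exists i => //=.
  rewrite (msize2_affine (sL i)) mevalD mevalC -/(cc i).
  have -> : (lform (cc i)).@[fun k => r * w k] = r * (lform (cc i)).@[w].
    by rewrite !lform_eval /dot; ring.
  by rewrite /r divfK // addNr.
rewrite /meval (mmap_homog _ _ _ homT) => /eqP.
by rewrite mulf_eq0 expf_eq0 (negPf r0) andbF => /eqP.
Qed.

End LinearFactors.

Section OrdinaryTangents.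
Variables (K : closedFieldType) (F : {mpoly K[3]}) (D : nat).
Hypotheses (homF : F \is D.-homog) (F0 : F != 0).
Variable x : 'rV[K]_3.
Let m := multiplicity F x.

(** A tangent that did not vanish at [x] would meet every line w + c x, and then the
    m-th Taylor form, which is constant on such lines, would be zero. *)
Lemma ordinary_tangents : ordinary F x -> exists cc : 'I_m -> 'I_3 -> K,
  [/\ taylor_form F x m = \prod_i lform (cc i), forall i, exists k, cc i k != 0,
      forall i, dot (x 0) (cc i) = 0 & forall i j, i != j -> ~ par (cc i) (cc j)].
Proof.
case=> L [irrL FL npL]; have T0 := taylor_form_mult F0 x.
have [cc LE] := linear_factors (taylor_form_homog F x m) T0 FL irrL.
exists cc.
have FmE : taylor_form F x m = \prod_i lform (cc i).
  by rewrite [LHS]FL; apply: eq_bigr => i _; rewrite LE.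
have cc0 i : exists k, cc i k != 0.
  apply/existsP; apply: contraT; rewrite negb_exists => /forallP z.
  have := T0; rewrite -/m FmE => /prodf_neq0/(_ i isT); rewrite /lform big1 ?eqxx // => k _.
  by have := z k; rewrite negbK => /eqP ->; rewrite scale0r.
split=> // [i|i j nij par_ij].
  apply/eqP; apply: contraT => xi.
  have [w Fw] := mpoly3_nonzero_eval T0.
  have := taylor_form_invariant homF F0 x (- dot w (cc i) / dot (x 0) (cc i)) w.
  rewrite -/m => eqF; case/negP: Fw; rewrite -/m -eqF FmE rmorph_prod.
  apply/prodf_eq0; exists i => //=; rewrite lform_eval.
  set c := _ / _.
  have -> : dot (fun k => w k + c * x 0 k) (cc i) = dot w (cc i) + c * dot (x 0) (cc i).
    by rewrite /dot; ring.
  by rewrite /c divfK // subrr.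
have [k cjk] := cc0 j; have eqc := par_scale cjk par_ij.
apply: (npL i j nij); exists (cc i k / cc j k).
  have [l cil] := cc0 i; apply: contraNneq cil => r0.
  by rewrite eqc r0 mul0r.
rewrite !LE /lform scaler_sumr; apply: eq_bigr => l _.
by rewrite scalerA -eqc.
Qed.

End OrdinaryTangents.

(** * Proper parametrizations *)

Section Points.
Variable K : closedFieldType.

Lemma rV3_neq0 (x : 'rV[K]_3) : x != 0 -> exists k, x 0 k != 0.
Proof.
move=> x0; apply/existsP; apply: contraNT x0; rewrite negb_exists => /forallP z.
by apply/eqP/rowP=> k; rewrite mxE; have := z k; rewrite negbK => /eqP.
Qed.

Lemma eqmx_par (x y : 'rV[K]_3) : x != 0 -> y != 0 ->
  reflect (par (x 0) (y 0)) (x == y)%MS.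
Proof.
have sub (u v : 'rV[K]_3) : v != 0 -> par (u 0) (v 0) -> (u <= v)%MS.
  move=> /rV3_neq0[k vk] puv; apply/sub_rVP; exists (u 0 k / v 0 k).
  by apply/rowP=> i; rewrite mxE; apply: (par_scale vk puv).
move=> x0 y0; apply: (iffP andP) => [[/sub_rVP[a ->] _] i j|pxy].
  by rewrite !mxE; ring.
by split; apply: sub => //; apply: par_sym.
Qed.

Lemma pointE (a b c : K) : (point a b c 0 0 = a) * (point a b c 0 1 = b)
   * (point a b c 0 2 = c).
Proof. by rewrite !mxE !(tnth_nth 0). Qed.

(** Up to sign the three polynomials whose gcd is the fibre function are the
    components of [cross3 P x]. *)
Lemma fibre_cross (p1 p2 p : {poly K}) (x : 'rV[K]_3) :
  let P k := tnth [tuple p1; p2; p] k in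
  let H := fibre_function p1 p2 p x in
  exists kap : 'I_3 -> {poly K},
    (forall k, cross3 P (polyC \o x 0) k = H * kap k) /\
    (H != 0 -> forall t, exists k, (kap k).[t] != 0).
Proof.
move=> P H; pose X := cross3 P (polyC \o x 0).
have XE : [/\ X 0 = - (x 0 1 *: p - x 0 2 *: p2), X 1 = x 0 0 *: p - x 0 2 *: p1
    & X 2 = - (x 0 0 *: p2 - x 0 1 *: p1)].
  rewrite /X /cross3 !ord3_add /P !(tnth_nth 0) /= -!mul_polyC.
  by split; ring.
have [X0 X1 X2] := XE.
have dvdH q : (q %| H) = [&& q %| X 0, q %| X 1 & q %| X 2].
  by rewrite /H /fibre_function !dvdp_gcd X0 X1 X2 !dvdpNr andbA [(_ %| _) && (_ %| _)]andbC.
have HX k : H %| X k.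
  have := dvdpp H; rewrite dvdH => /and3P[h0 h1 h2].
  by case: (ord3P k) => ->.
exists (fun k => X k %/ H); split=> [k|H0 t]; first by rewrite mulrC divpK.
apply/existsP; apply: contraT; rewrite negb_exists => /forallP z.
have dv k : H * ('X - t%:P) %| X k.
  rewrite -[X k](divpK (HX k)) mulrC dvdp_mul2r // dvdp_XsubCl.
  by have := z k; rewrite negbK.
have : H * ('X - t%:P) %| H by rewrite dvdH !dv.
move=> /(dvdp_leq H0); rewrite size_Mmonic ?monicXsubC // size_XsubC addn2 /=.
by rewrite ltnn.
Qed.

End Points.

Lemma prod_dvdp (K : fieldType) (I : eqType) (r : seq I) (g : I -> {poly K}) f :
  uniq r -> (forall i j, i != j -> coprimep (g i) (g j)) ->
  (forall i, g i %| f) -> \prod_(i <- r) g i %| f.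
Proof.
move=> ur cg gf; elim: r ur => [|i r IH] /=; first by rewrite big_nil dvd1p.
move=> /andP[ir ur]; rewrite big_cons Gauss_dvdp ?gf ?IH //.
rewrite big_seq; elim/big_ind: _ => [|q1 q2 h1 h2|j rj].
- exact: coprimep1.
- by rewrite coprimepMr h1.
- by apply: cg; apply: contraNneq ir => ->.
Qed.

(** If the coefficients in the maximal degree cancel, then [f] and [p] are proportional and
    [cross f p] is zero. *)
Lemma size_cross_eq (K : closedFieldType) (f p : {poly K}) :
  p != 0 -> cross f p != 0 -> size (cross f p) = maxn (size f) (size p).
Proof.
move=> p0 cr0; apply/eqP; rewrite eqn_leq size_cross /=.
have pgt : (0 < maxn (size f) (size p))%N by rewrite leq_max !size_poly_gt0 p0 orbT.
pose a := (maxn (size f) (size p)).-1.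
rewrite -(prednK pgt) -/a ltnNge; apply: contra cr0 => le_a.
have := nth_default 0 le_a; rewrite /cross coefB !coefCM !coef_map /=.
move=> /eqP; rewrite subr_eq0 mulrC [X in _ == X]mulrC => /eqP e.
have [pa0|pa0] := eqVneq p`_a 0.
  have fa0 : f`_a != 0.
    have [le_fp|lt_pf] := leqP (size f) (size p).
      by move: pa0; rewrite /a (maxn_idPr le_fp) -lead_coefE => /eqP; rewrite lead_coef_eq0 (negPf p0).
    rewrite /a (maxn_idPl (ltnW lt_pf)) -lead_coefE lead_coef_eq0 -size_poly_eq0.
    by apply: contraTneq lt_pf => ->.
  move: e; rewrite pa0 mul0r => /esym/eqP; rewrite mulf_eq0 polyC_eq0 (negPf fa0).
  by rewrite (negPf p0).
have fE : f = (f`_a / p`_a) *: p.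
  apply: (mulfI (x := (p`_a)%:P)); rewrite ?polyC_eq0 // e.
  by rewrite [RHS]mul_polyC scalerA [p`_a * _]mulrC divfK // mul_polyC.
move: fE; move: (_ / _) => g ->; rewrite /cross -mul_polyC !rmorphM /= map_polyC /=.
by apply/eqP; ring.
Qed.

Section Main.
Variables (K : closedFieldType) (charK : [pchar K] =i pred0).
Variables (F : {mpoly K[3]}) (p1 p2 p : {poly K}).
Hypotheses (F_curve : curve_form F) (F_not_line : F \isn't 1.-homog)
  (P_param : parametrizes F p1 p2 p) (P_coprime : gcdp (gcdp p1 p2) p %= 1)
  (P_proper : proper_param F p1 p2 p).

Let P (k : 'I_3) := tnth [tuple p1; p2; p] k.

Lemma param_atE t k : param_at p1 p2 p t 0 k = (P k).[t].
Proof.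
by rewrite /param_at /P; case: (ord3P k) => ->; rewrite pointE (tnth_nth 0).
Qed.

Lemma param_eval (G : {mpoly K[3]}) t :
  form_at G (param_at p1 p2 p t) = G.@[fun k => (P k).[t]].
Proof. by apply: meval_eq => k; rewrite param_atE. Qed.

Lemma param_cop t : exists k, (P k).[t] != 0.
Proof.
apply/existsP; apply: contraT; rewrite negb_exists => /forallP z.
have z' k : root (P k) t by have := z k; rewrite negbK.
have : root (gcdp (gcdp p1 p2) p) t by rewrite !root_gcd (z' 0) (z' 1) (z' 2).
by rewrite (eqp_root P_coprime) (negPf (root1 t)).
Qed.

Lemma param_at_neq0 t : param_at p1 p2 p t != 0.
Proof.
have [k Pk] := param_cop t; apply: contraNneq Pk => x0.
by rewrite -param_atE x0 mxE.
Qed.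

Lemma param_proper : exists e (M N : {mpoly K[3]}),
  [/\ M \is e.-homog, N \is e.-homog,
      exists t, N.@[fun k => (P k).[t]] != 0 &
      forall t, N.@[fun k => (P k).[t]] != 0 ->
        M.@[fun k => (P k).[t]] / N.@[fun k => (P k).[t]] = t].
Proof.
have [e [M [N [[hM hN] [t Nt] MN _]]]] := P_proper.
exists e, M, N; split=> //; first by exists t; rewrite -param_eval.
by move=> t'; rewrite -!param_eval; apply: MN.
Qed.

(** Otherwise all parameters would give the same point, and the inverse of the
    parametrization could not tell them apart. *)
Lemma param_not_fixed (x : 'I_3 -> K) j : x j != 0 ->
  exists t, ~ par (fun k => (P k).[t]) x.
Proof.
move=> xj; have [e [M [N [hM hN N0 MN]]]] := param_proper.
have dn0 := den_poly_neq0 N0.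
have /closed_nonrootP[t1 nt1] := dn0.
have dn1 : den_poly P N * ('X - t1%:P) != 0 by rewrite mulf_neq0 // polyXsubC_eq0.
have /closed_nonrootP[t2] := dn1.
rewrite rootM root_XsubC negb_or => /andP[nt2 nt12].
have [/parP par1|/parP] := boolP [forall i, forall k, (P i).[t1] * x k == (P k).[t1] * x i];
  last by move=> npar; exists t1.
have [/parP par2|/parP] := boolP [forall i, forall k, (P i).[t2] * x k == (P k).[t2] * x i];
  last by move=> npar; exists t2.
have cf t : par (fun k => (P k).[t]) x -> (P j).[t] / x j != 0.
  move=> pt; rewrite mulf_neq0 ?invr_eq0 //; have [k] := param_cop t.
  by apply: contraNneq => Pj; rewrite (par_scale xj pt k) Pj !mul0r.
have := cf _ par1; have := cf _ par2.
set c2 := _ / _ => c20; set c1 := _ / _ => c10.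
case/eqP: nt12; apply: (param_inj hM hN MN (c := c2 / c1)) => //.
  by rewrite mulf_neq0 ?invr_eq0.
by move=> k; rewrite (par_scale xj par2 k) (par_scale xj par1 k) -/c1 -/c2 mulrA divfK.
Qed.

Let d := param_degree p1 p2 p.

Lemma size_param k : (size (P k) <= d.+1)%N.
Proof.
have le1 (q : {poly K}) : ((size q).-1 <= d)%N -> (size q <= d.+1)%N.
  by case: (size q).
by case: (ord3P k) => ->; apply: le1; rewrite /P (tnth_nth 0) /= /d /param_degree
  !leq_max leqnn ?orbT.
Qed.

Lemma param_degree_gt0 : (0 < d)%N.
Proof.
rewrite lt0n; apply/eqP=> d0.
have [j Pj] := param_cop 0.
have [t] := param_not_fixed (x := fun k => (P k).[0]) Pj; case.
have cst k : (P k).[t] = (P k).[0].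
  have /size1_polyC -> : (size (P k) <= 1)%N by rewrite -[1%N]/(0.+1)%N -d0 size_param.
  by rewrite !hornerC.
by move=> i k; rewrite !cst mulrC.
Qed.

Lemma param_top : exists k, (P k)`_d != 0.
Proof.
have d_gt0 := param_degree_gt0.
have lc (q : {poly K}) : (size q).-1 = d -> q`_d != 0.
  move=> sq; rewrite -sq -lead_coefE lead_coef_eq0 -size_poly_eq0.
  by apply: contraTneq d_gt0 => q0; rewrite -sq q0.
have : [\/ (size p1).-1 = d, (size p2).-1 = d | (size p).-1 = d].
  rewrite /d /param_degree; case: (leqP (maxn _ _)) => _; last first.
    by case: (leqP (size p1).-1) => _; [apply: Or32 | apply: Or31].
  exact: Or33.
case=> /lc nz; [exists 0 | exists 1 | exists 2]; by rewrite /P (tnth_nth 0).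
Qed.

Lemma limit_pointE k : limit_point p1 p2 p 0 k = (P k)`_d.
Proof.
by rewrite /limit_point /P; case: (ord3P k) => ->; rewrite pointE (tnth_nth 0).
Qed.

Lemma limit_point_neq0 : limit_point p1 p2 p != 0.
Proof.
have [k Pk] := param_top; apply: contraNneq Pk => x0.
by rewrite -limit_pointE x0 mxE.
Qed.

Section Assembly.
Variable n : nat.
Hypothesis dE : d = n.+1.
Variables (D : nat) (c : K).
Hypotheses (homF : F \is D.-homog) (F_bez : F = c *: bez_form n P).

Let sP k : (size (P k) <= n.+2)%N.
Proof. by rewrite -dE size_param. Qed.

Let F0 : F != 0.
Proof. exact: irr_neq0 F_curve.2. Qed.

Let FP t : F.@[fun k => (P k).[t]] = 0.
Proof. by rewrite -param_eval P_param. Qed.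

Lemma form_degree : D = n.+1.
Proof.
have [v Fv] := mpoly3_nonzero_eval F0.
have eqX : 'X^D - 'X^(n.+1) = 0 :> {poly K}.
  apply: (@poly_ext_cofinite _ _ 1) => [|t _]; rewrite ?oner_eq0 //.
  apply: (mulIf Fv); rewrite mul0r !hornerE mulrBl.
  have -> : t ^+ D * F.@[v] = F.@[fun k => t * v k].
    by rewrite /meval (mmap_homog _ _ _ homF).
  rewrite F_bez !mevalZ !meval_bez_form pencilZ detZ.
  by ring.
have := congr1 (fun q : {poly K} => size q) (subr0_eq eqX).
by rewrite !size_polyXn => -[].
Qed.

Lemma n_gt0 : (0 < n)%N.
Proof.
rewrite lt0n; apply: contraNneq F_not_line => n0.
by have := homF; rewrite form_degree n0.
Qed.

(** The fibre function is not zero because a proper parametrization is not constant. *)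
Lemma fibre_data (x : 'rV[K]_3) : x != 0 ->
  let H := fibre_function p1 p2 p x in
  H != 0 /\ exists kap : 'I_3 -> {poly K},
    (forall k, cross3 P (polyC \o x 0) k = H * kap k) /\
    (forall t, exists k, (kap k).[t] != 0).
Proof.
move=> x0 H; have [kap [HX cop]] := fibre_cross p1 p2 p x.
have H0 : H != 0.
  have [j xj] := rV3_neq0 x0; have [t] := param_not_fixed (x := x 0) xj.
  apply: contra_notN => /eqP H0; apply: par_cross => k.
  have := congr1 (fun q : {poly K} => q.[t]) (HX k).
  by rewrite -/H H0 mul0r horner0 /cross3 /= !hornerE.
by split=> //; exists kap; split=> //; apply: cop.
Qed.

Lemma root_fibreP (x : 'rV[K]_3) t : x != 0 ->
  reflect (par (fun k => (P k).[t]) (x 0)) (root (fibre_function p1 p2 p x) t).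
Proof.
move=> x0; suff e : root (fibre_function p1 p2 p x) t
    <-> par (fun k => (P k).[t]) (x 0) by apply: (iffP idP) => /e.
have [H0 [kap [HX cop]]] := fibre_data x0.
have HXt k : cross3 (fun i => (P i).[t]) (x 0) k
    = (fibre_function p1 p2 p x).[t] * (kap k).[t].
  have := congr1 (fun q : {poly K} => q.[t]) (HX k).
  by rewrite [in RHS]hornerM => <-; rewrite /cross3 /= !hornerE.
split=> [/rootP r|par_x].
  by apply: par_cross => k; rewrite HXt r mul0r.
have [k kt] := cop t; have := cross_par par_x k; rewrite HXt => /eqP.
by rewrite mulf_eq0 (negPf kt) orbF.
Qed.

(** The restriction of F to a generic line through [x] has degree at most d - m in the
    coordinate that is infinite at [x], and d - deg H distinct zeros; so m is at most
    deg H, and [fibre_corank_dvd_minor] applies. *)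
Lemma fibre_power_dvd_minor (x : 'rV[K]_3) : x != 0 ->
  ~~ (x == limit_point p1 p2 p)%MS ->
  fibre_function p1 p2 p x ^+ (multiplicity F x - 1) %| pencil_minor n P.
Proof.
move=> x0 nlim; have [H0 [kap [HX cop]]] := fibre_data x0.
set H := fibre_function p1 p2 p x in H0 HX *.
have [j xj] := rV3_neq0 x0.
have notlim : ~ par (fun k => (P k)`_n.+1) (x 0).
  move=> /par_sym pl; case/negP: nlim; apply/eqmx_par; rewrite ?limit_point_neq0 //.
  by move=> i k; rewrite !limit_pointE dE.
have [e [M [N [hM hN N0 MN]]]] := param_proper.
have [E E0 EQ] := generic_line charK sP hM hN N0 MN HX cop notlim.
have EF0 : E * F != 0 by rewrite mulf_neq0.
have [Q] := mpoly3_nonzero_eval EF0; rewrite mevalM mulf_eq0 => /norP[EQ0 FQ].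
have [ys [uys sys ysP]] := EQ Q EQ0.
have le_m : (n.+1 - (size H).-1 <= n.+1 - multiplicity F x)%N.
  pose f := mmap polyC (fun k => (Q k)%:P + 'X * (x 0 k)%:P) F.
  have fE y : f.[y] = F.@[fun k => Q k + y * x 0 k].
    rewrite -/(horner_eval y _) /f map_mmap; apply: eq_mmap => [a|k] /=;
      by rewrite /horner_eval !hornerE.
  have f0 : f != 0.
    apply: contraNneq FQ => f0; have := fE 0; rewrite f0 horner0 => /esym.
    by rewrite (meval_eq (v2 := Q)) => [->//|k]; rewrite mul0r addr0.
  have rts : all (root f) ys.
    apply/allP=> y /ysP[t [a a0 aE]]; apply/rootP.
    by rewrite fE (meval_eq _ aE) /meval (mmap_homog _ _ _ homF) -/(meval _ _) FP mulr0.
  have := max_poly_roots f0 rts uys; rewrite sys => /leq_trans/(_ (size_line_through homF x Q)).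
  by rewrite ltnS form_degree.
have le_mD : (multiplicity F x <= n.+1)%N.
  by rewrite -form_degree (mult_le_deg homF).
apply: dvdp_trans (fibre_corank_dvd_minor sP HX cop H0 xj).
by apply: dvdp_exp2l; move: le_m le_mD; clear; lia.
Qed.

Lemma minor_order_le (x : 'rV[K]_3) s0 : x != 0 -> singular F x -> ordinary F x ->
  root (fibre_function p1 p2 p x) s0 ->
  ~~ (('X - s0%:P) ^+ (mup s0 (fibre_function p1 p2 p x) * (multiplicity F x - 1)).+1
       %| pencil_minor n P).
Proof.
move=> x0 sx ox rs0; have [H0 [kap [HX cop]]] := fibre_data x0.
have [cc [Fm cc0 ccx ccn]] := ordinary_tangents homF F0 ox.
have [j xj] := rV3_neq0 x0.
apply: (minor_order_le_ordinary sP homF F0 F_bez FP param_cop xj HX cop H0 _ cc0 ccx ccn Fm rs0).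
exact: ltnW.
Qed.

Lemma minor_neq0_off_singular s0 : ~ singular F (param_at p1 p2 p s0) -> (pencil_minor n P).[s0] != 0.
Proof.
set x := param_at p1 p2 p s0 => nsing.
apply: (minor_neq0_regular sP F_bez (x := x)); first by move=> k; rewrite param_atE.
have mE : multiplicity F x = 1%N.
  have m_gt0 : multiplicity F x != 0%N.
    apply: contraNneq (taylor_form_mult F0 x) => m0; rewrite m0.
    apply/eqP/mpoly3_ext => u; rewrite meval0 -coef_taylor_line -horner_coef0.
    rewrite -/(horner_eval 0 _) map_mmap -[RHS](FP s0).
    apply: eq_mmap => [a|k] /=; rewrite /horner_eval !hornerE //.
    by rewrite param_atE.
  by move/negP: nsing; rewrite /singular -leqNgt; move: m_gt0; case: (multiplicity F x) => [|[]].
by have := taylor_form_mult F0 x; rewrite mE.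
Qed.


Lemma curve_pencil_neq0 : pencil_minor n P != 0 -> curve_pencil n P != 0.
Proof.
apply: contraNneq => cp0; rewrite /pencil_minor cp0.
have -> : row' ord0 (col' ord0 (0 : 'M[{poly K}]_n.+1)) = 0.
  by apply/matrixP=> i j; rewrite !mxE.
by have := n_gt0; rewrite /=; case: (n) => // n' _; rewrite det0.
Qed.

(** If [p], G_1 or G_2 were zero, the curve pencil would be zero, and its minor too. *)
Lemma T_function_eq_minor : pencil_minor n P != 0 ->
  exists2 a : K, a != 0 & T_function p1 p2 p = tofrac (a *: pencil_minor n P).
Proof.
move=> t0; have cp0 := curve_pencil_neq0 t0.
have p0 : p != 0.
  apply: contraNneq cp0 => p0; apply/eqP/matrixP=> i j; rewrite !mxE /dot.
  rewrite /lift_curve !ord3_add /P !(tnth_nth 0) /= p0 mul0r addr0 /bez_row.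
  by rewrite map_poly0 !drop_poly0r !(mulr0, mul0r, subrr, coef0, addr0, oppr0).
have bz := bezmx_cross n p1 p2 p.
have cross0 : cross p1 p != 0 /\ cross p2 p != 0.
  have nz (f g : {poly {poly K}}) : bezmx n.+1 f g = p *: curve_pencil n P ->
      f != 0 /\ g != 0.
    move=> e; have pcp : p *: curve_pencil n P != 0.
      by rewrite scalemx_eq0 negb_or p0.
    by split; apply: contraNneq pcp => z; rewrite -e z; apply/eqP/matrixP=> i j;
      rewrite !mxE /bez_row drop_poly0r !(mulr0, mul0r, subrr, coef0, oppr0).
  exact: nz bz.
apply: T_function_minor => //; first by apply: size_cross_eq; case: cross0.
- by apply: size_cross_eq; case: cross0.
have [k Pk] := param_top; exists k; apply/eqP; rewrite eqn_leq sP ltnNge.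
by apply: contra Pk => le_k; rewrite nth_default // dE.
Qed.

End Assembly.

End Main.

Theorem theorem3 (K : closedFieldType) (charK : [pchar K] =i pred0)
    (F : {mpoly K[3]}) (p1 p2 p : {poly K})
    (F_curve : curve_form F)
    (F_not_line : F \isn't 1.-homog)
    (P_param : parametrizes F p1 p2 p)
    (P_coprime : gcdp (gcdp p1 p2) p %= 1)
    (P_proper : proper_param F p1 p2 p)
    (n : nat) (P : 'I_n -> 'rV[K]_3) (m : 'I_n -> nat)
    (P_neq0 : forall i, P i != 0)
    (P_distinct : forall i j, i != j -> ~~ (P i == P j)%MS)
    (P_singular : forall x : 'rV[K]_3, x != 0 ->
       singular F x <-> exists i, (x == P i)%MS)
    (m_mult : forall i, m i = multiplicity F (P i))
    (P_ordinary : forall i, ordinary F (P i))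
    (P_not_limit : forall i, ~~ (P i == limit_point p1 p2 p)%MS) :
  exists2 c : K, c != 0 &
    T_function p1 p2 p
      = tofrac (c *: \prod_(i < n) fibre_function p1 p2 p (P i) ^+ (m i - 1)).
Proof.
pose Q (k : 'I_3) := tnth [tuple p1; p2; p] k.
have d_gt0 := param_degree_gt0 P_coprime P_proper.
have [r dE] : exists r, param_degree p1 p2 p = r.+1.
  by case: (param_degree p1 p2 p) d_gt0 => // r _; exists r.
have sQ k : (size (Q k) <= r.+2)%N by rewrite -dE; apply: size_param.
have /homogP[D homF] := F_curve.1.
have FQ t : F.@[fun k => (Q k).[t]] = 0 by rewrite -param_eval P_param.
have [e [M [N [hM hN N0 MN]]]] := param_proper P_proper.
have topQ : exists k, (Q k)`_r.+1 != 0.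
  by have := param_top P_coprime P_proper; rewrite dE.
have copQ := param_cop P_coprime.
have [c c0 F_bez] := implicit_bez_form charK sQ topQ copQ homF F_curve.2 FQ hM hN N0 MN.
have r_gt0 := n_gt0 F_curve F_not_line homF F_bez.
pose H i := fibre_function p1 p2 p (P i).
pose T := pencil_minor r Q.
have sing_P i : singular F (P i) by apply/P_singular => //; exists i; apply/andP.
have H0 i : H i != 0 by have [] := fibre_data P_coprime P_proper (P_neq0 i).
have rootH i t := root_fibreP P_coprime P_proper t (P_neq0 i).
have local s0 : (exists2 i, root (H i) s0 &
     ~~ (('X - s0%:P) ^+ (mup s0 (H i) * (m i - 1)).+1 %| T)) \/ T.[s0] != 0.
  have x0 := param_at_neq0 P_coprime s0.
  have [/existsP[i ri]|/existsPn nr] := boolP [exists i, root (H i) s0].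
    left; exists i => //; rewrite m_mult.
    exact: (minor_order_le F_curve P_param P_coprime P_proper dE homF F_bez).
  right; apply: (minor_neq0_off_singular F_curve P_param dE F_bez) => /P_singular[//|i].
  move/(eqmx_par x0 (P_neq0 i)) => pi; case/negP: (nr i); apply/rootH => a b.
  by rewrite -!param_atE pi.
have T0 : T != 0.
  by case: (local 0) => [[i _]|]; apply: contraNneq => ->; rewrite ?dvdp0 ?horner0.
have coH i j : i != j -> coprimep (H i ^+ (m i - 1)) (H j ^+ (m j - 1)).
  move=> nij; apply/coprimep_expl/coprimep_expr.
  rewrite /coprimep; apply: contraT => /closed_rootP[t]; rewrite root_gcd => /andP[].
  move=> /rootH pi /rootH pj; have [k Qk] := copQ t.
  case/negP: (P_distinct i j nij); apply/eqmx_par => //.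
  exact: (@par_trans _ _ (fun k => (Q k).[t]) _ k Qk (par_sym pi) pj).
have dvT : \prod_(i < n) H i ^+ (m i - 1) %| T.
  apply: prod_dvdp => [|i j nij|i]; first exact: index_enum_uniq.
    exact: coH.
  rewrite m_mult.
  exact: (fibre_power_dvd_minor charK F_curve P_param P_coprime P_proper dE homF F_bez).
have [q Tq] := dvdpP _ _ dvT.
(* At each parameter the upper bound for the order of T is the order of the product. *)
have q1 : size q == 1%N.
  apply: contraT => /closed_rootP[s0 rq].
  case: (local s0) => [[i ri]|]; last by rewrite Tq hornerM (rootP rq) mul0r eqxx.
  case/negP; rewrite Tq exprS dvdp_mul ?dvdp_XsubCl //.
  rewrite (bigD1 i) //= dvdp_mulr // exprM.
  by rewrite dvdp_exp2r // -mup_geq.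
have [a a0 qE] := size_poly1P q q1.
have [b b0 ->] := T_function_eq_minor F_curve F_not_line P_coprime P_proper dE homF F_bez T0.
exists (b * a); first by rewrite mulf_neq0.
by rewrite -/T Tq qE mul_polyC scalerA.
Qed.
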